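(* Let $\Psi$ be a Young function with $\Psi(t)/t^2\downarrow0$ as $t\downarrow0$. Then there exist compact sets $K\subset\mathbb{T}$ of Lebesgue measure arbitrarily close to full (i.e. for every $\varepsilon>0$ there is such a $K$ with $m(K)>1-\varepsilon$) with the following property: for any $f\in\ell^{\Psi}_a$ and any continuous function $g$ on $K$, there exist holomorphic polynomials $(Q_n)_n$ such that $$\lim_{n}\Big(\|Q_n-f\|_\Psi+\sup_{z\in K}|Q_n(z)-g(z)|\Big)=0.$$
   Context: $\mathbb{D}$ is the open unit disc, $\mathbb{T}$ the unit circle, $m$ normalized Lebesgue measure on $\mathbb{T}$ (so $m(\mathbb{T})=1$). Holomorphic polynomials are polynomials in $z$ with complex coefficients. For a holomorphic function $f$ on $\mathbb{D}$, $(\widehat f(n))_{n\ge0}$ denotes its Taylor coefficients at $0$. A Young function is a convex function $\Psi$ on $[0,\infty)$ with $\Psi(0)=0$, $\Psi(x)>0$ for $x>0$, and $\Psi(2x)\asymp\Psi(x)$ as $x\to0$ (two-sided bounds with positive constants for small $x>0$). The notation $\Psi(t)/t^2\downarrow0$ as $t\downarrow0$ means that $\Psi(t)/t^2$ decreases monotonically to $0$ as $t$ decreases to $0$. The space $\ell^{\Psi}_a$ consists of all holomorphic $f$ on $\mathbb{D}$ with $\sum_{n=0}^\infty\Psi(|\widehat f(n)|)<\infty$, with norm $$\|f\|_\Psi=\inf\Big\{M>0:\sum_{n=0}^\infty\Psi\big(|\widehat f(n)|/M\big)\le1\Big\}.$$ *)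

(* Defs.v *)
From mathcomp Require Import all_boot all_order all_algebra.
From mathcomp Require Import complex.
From mathcomp Require Import all_classical all_reals all_analysis.

Set Implicit Arguments.
Unset Strict Implicit.
Unset Printing Implicit Defensive.

Import Order.TTheory GRing.Theory Num.Theory.
Import numFieldNormedType.Exports.

Local Open Scope classical_set_scope.
Local Open Scope ring_scope.

(* The regular alias ^o carries the topology given by the modulus; [CC R] is
   convertible to [R[i]]. *)
Notation CC R := (R[i]^o)%type.

(* The modulus as an element of [R]: the norm `|z| of [R[i]] is itself an
   element of [R[i]]. *)
Definition modulus (R : realType) (z : CC R) : R := complex.Re `|z|.

Definition young (R : realType) (Psi : R -> R) : Prop :=
  [/\ convex_function (`[0, +oo[ : set R^o) Psi,
      Psi 0 = 0,
      (forall x, 0 < x -> 0 < Psi x) &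
      exists c1 c2 : R, [/\ 0 < c1, 0 < c2 &
        \forall x \near 0^'+, c1 * Psi x <= Psi (2 * x) <= c2 * Psi x]].

(* Psi(t)/t^2 decreases to 0 as t decreases to 0; as the limit is at 0, the
   monotonicity is only required on some interval ]0, d[. *)
Definition ratio_decreases_to0 (R : realType) (Psi : R -> R) : Prop :=
  (exists2 d : R, 0 < d &
     forall s t, 0 < s -> s <= t -> t < d -> Psi s / s ^+ 2 <= Psi t / t ^+ 2)
  /\ Psi t / t ^+ 2 @[t --> 0^'+] --> (0 : R).

Definition unit_disc (R : realType) : set (CC R) := [set z | modulus z < 1].

Definition unit_circle (R : realType) : set (CC R) := [set z | modulus z = 1].

(* Normalized Lebesgue measure on the circle: the image of Lebesgue measure on
   [0, 1[ under t |-> exp(2 pi i t). *)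
Definition circle_param (R : realType) (t : R) : CC R :=
  Complex (cos (2 * pi * t)) (sin (2 * pi * t)).

Definition circle_measure (R : realType) (A : set (CC R)) : \bar R :=
  lebesgue_measure (`[0, 1[ `&` @circle_param R @^-1` A).

Definition holomorphic (R : realType) (U : set (CC R)) (f : CC R -> CC R) : Prop :=
  forall z, U z -> derivable f z 1.

(* A holomorphic function on the disc is the sum there of its Taylor series at
   0, and of no other power series; [taylor f] is that sequence of coefficients.
   The default value 0 only occurs for f not holomorphic on the disc. *)
Definition taylor (R : realType) (f : CC R -> CC R) : nat -> CC R :=
  xget (fun=> 0) [set a : nat -> CC R | forall z, unit_disc z ->
    [series a k * z ^+ k]_k @ \oo --> f z].

Definition psi_sum (R : realType) (Psi : R -> R) (f : CC R -> CC R) (M : R)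
    : \bar R :=
  (\sum_(0 <= n <oo) (Psi (modulus (taylor f n) / M))%:E)%E.

Definition ellPsi (R : realType) (Psi : R -> R) : set (CC R -> CC R) :=
  [set f | holomorphic (@unit_disc R) f /\ (psi_sum Psi f 1 < +oo)%E].

(* The infimum is taken in \bar R, where that of the empty set is +oo. *)
Definition norm_Psi (R : realType) (Psi : R -> R) (f : CC R -> CC R) : \bar R :=
  ereal_inf [set M%:E | M in [set M : R | 0 < M /\ (psi_sum Psi f M <= 1)%E]].

Definition sup_on (R : realType) (K : set (CC R)) (h : CC R -> CC R) : \bar R :=
  ereal_sup [set (modulus (h z))%:E | z in K].

(* Main.v *)
Require Import Defs.
From mathcomp Require Import all_boot all_order all_algebra.
From mathcomp Require Import cyclic separable cyclotomic.
From mathcomp Require Import complex.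
From mathcomp Require Import all_classical all_reals all_analysis.
From mathcomp Require Import ring lra zify.
Import Order.TTheory GRing.Theory Num.Theory.
Import numFieldNormedType.Exports.
Local Open Scope classical_set_scope.
Local Open Scope ring_scope.

(** Why the theorem holds.  The pairs consisting of a polynomial Q and of its
    restriction to K have to be dense in ell^Psi_a x C(K).  Suppose that K
    carries polynomials p that are negligible for the Psi-norm, close to 1 on
    K, and divisible by high powers of z.  If P(z) / z^m is a Laurent
    polynomial, then P(z) / z^m * p(z) is again a polynomial, still negligible,
    and it is close to P(z) / z^m on K.  Laurent polynomials are dense in C(K)
    ([laurent_dense]), so any h in C(K) is the uniform limit on K of
    polynomials that tend to 0 in norm; with S a Taylor polynomial of f and
    h = g - S, the sum of S and such a polynomial is close to f in norm and to
    g on K ([approximation]).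

    As Psi(t) = o(t^2), a polynomial with bounded square-summed coefficients,
    all of which are tiny, has a tiny norm.  The analytic core is therefore
    [exists_flat_near_1]: polynomials p close to 1 off a set of small measure,
    bounded by a constant M that depends only on this closeness and on the
    measure of that set, with coefficients as small as desired and frequencies as high as desired.  The
    set K is the circle minus the exceptional sets of a sequence of them.

    Such a p is 1 - F, where F imitates planar Brownian motion started at 1 and
    stopped at the boundary of an annulus r < |w| < M.  A move adds to F a
    polynomial c z^s P(z), where s exceeds the degree of F and |P| is less
    than the distance from F to the boundary.  The new coefficients do
    not interfere with the old ones and are bounded by sup |P|; averaging over
    the unimodular constant c makes the move isotropic at each point of the
    circle ([exists_perturbation]).  As ln |w| is harmonic, its mean hardly
    changes under such moves, so |F| is rarely of size M once M is large.  As
    |w|^2 is strictly subharmonic, the moves can only die out near the boundary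
    of the annulus.  Hence |F| is close to r on most of the circle.  The end
    of the motion is caught in one stroke, as an almost minimizer of the mean of
    the superharmonic potential ln |F| - beta |F|^2 among all the polynomials
    that moves could reach ([near_extremal]). *)

(** * The modulus and the topology of the complex plane *)

Lemma normE {R : realType} (z : CC R) : `|z| = (modulus z)%:C%C.
Proof. by case: z. Qed.

Lemma modulus_ge0 {R : realType} (z : CC R) : 0 <= modulus z.
Proof. by rewrite -ler0c -normE. Qed.

Lemma modulusM {R : realType} (z w : CC R) :
  modulus (z * w : CC R) = modulus z * modulus w.
Proof. by apply: (@complexI R); rewrite -normE normrM !normE rmorphM. Qed.

Lemma modulusD {R : realType} (z w : CC R) :
  modulus (z + w : CC R) <= modulus z + modulus w.
Proof. by rewrite -lecR rmorphD /= -!normE ler_normD. Qed.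

Lemma modulusN {R : realType} (z : CC R) : modulus (- z : CC R) = modulus z.
Proof. by rewrite /modulus normrN. Qed.

Lemma modulusBC {R : realType} (z w : CC R) :
  modulus (z - w : CC R) = modulus (w - z : CC R).
Proof. by rewrite /modulus distrC. Qed.

Lemma modulusB {R : realType} (z w : CC R) :
  modulus (z - w : CC R) <= modulus z + modulus w.
Proof. by rewrite (le_trans (modulusD _ _)) ?modulusN. Qed.

Lemma modulusB_ge {R : realType} (z w : CC R) :
  modulus z - modulus w <= modulus (z - w : CC R).
Proof. by rewrite lerBlDr (le_trans _ (modulusD _ _)) // subrK. Qed.

Lemma modulus0 {R : realType} : modulus (0 : CC R) = 0.
Proof. by rewrite /modulus normr0. Qed.

Lemma modulus1 {R : realType} : modulus (1 : CC R) = 1.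
Proof. by rewrite /modulus normr1. Qed.

Lemma modulus0_eq0 {R : realType} (z : CC R) : modulus z = 0 -> z = 0.
Proof. by move=> z0; apply/normr0_eq0; rewrite normE z0. Qed.

Lemma modulusX {R : realType} (z : CC R) n :
  modulus (z ^+ n : CC R) = modulus z ^+ n.
Proof. by apply: (@complexI R); rewrite -normE normrX !normE rmorphXn. Qed.

Lemma modulusV {R : realType} (z : CC R) : modulus (z^-1 : CC R) = (modulus z)^-1.
Proof. by apply: (@complexI R); rewrite -normE normfV !normE fmorphV. Qed.

Lemma modulus_real {R : realType} (x : R) : modulus (x%:C%C : CC R) = `|x|.
Proof. by rewrite /modulus /= expr0n /= addr0 sqrtr_sqr. Qed.

Lemma modulus_sqr {R : realType} (z : CC R) :
  modulus z ^+ 2 = complex.Re z ^+ 2 + complex.Im z ^+ 2.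
Proof. by case: z => a b; rewrite /modulus /= sqr_sqrtr ?addr_ge0 ?sqr_ge0. Qed.

Lemma modulus_sum {R : realType} (I : Type) (s : seq I) (P : pred I)
    (F : I -> CC R) :
  modulus (\sum_(i <- s | P i) F i : CC R) <= \sum_(i <- s | P i) modulus (F i).
Proof.
elim/big_ind2: _ => //; first by rewrite modulus0.
by move=> x1 x2 y1 y2 h1 h2; rewrite (le_trans (modulusD _ _)) ?lerD.
Qed.

Lemma parallelogram {R : realType} (z w : CC R) :
  modulus (z + w : CC R) ^+ 2 + modulus (z - w : CC R) ^+ 2
  = 2 * (modulus z ^+ 2 + modulus w ^+ 2).
Proof. by rewrite !modulus_sqr; case: z => a b; case: w => c d /=; ring. Qed.

(** Convergence in [CC R] is tested by tolerances in [R[i]]; the positive ones are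
    real, and everything below is estimated with real tolerances. *)
Lemma cvg_modulus {R : realType} {T : Type} {F : set_system T} {FF : Filter F}
    (f : T -> CC R) (l : CC R) :
  f @ F --> l <-> (forall e : R, 0 < e -> \forall x \near F, modulus (l - f x : CC R) < e).
Proof.
split=> [/cvgrPdist_lt h e e0|h].
  have e0' : 0 < (e%:C : R[i])%C by rewrite ltcR.
  by move: (h _ e0'); apply: filterS => x; rewrite normE ltcR.
apply/cvgrPdist_lt => -[e e'] /=; rewrite ltcE /= => /andP[/eqP -> e0].
by move: (h _ e0); apply: filterS => x; rewrite normE ltcR.
Qed.

Lemma modulus_continuous {R : realType} : continuous (@modulus R : CC R -> R).
Proof.
move=> z; apply: (iffRL (@cvgrPdist_lt _ _ _ (nbhs (z : CC R)) _ _ _)) => e e0.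
have : \forall w \near (z : CC R), modulus (z - w : CC R) < e.
  by apply: (iffLR (@cvg_modulus R _ (nbhs (z : CC R)) _ id z)) => //; exact: cvg_id.
apply: filterS => w /=.
apply: le_lt_trans; rewrite ler_norml modulusB_ge andbT lerNl opprB modulusBC.
exact: modulusB_ge.
Qed.

Lemma circle_param_unit {R : realType} (t : R) : modulus (circle_param t) = 1.
Proof. by rewrite /modulus /= cos2Dsin2 sqrtr1. Qed.

Lemma circle_param_continuous {R : realType} :
  continuous (@circle_param R : R -> CC R).
Proof.
move=> t; apply/cvg_modulus => e e0.
have e2 : 0 < e / 2 by rewrite divr_gt0.
have ct : (fun x : R => 2 * pi * x) @ t --> 2 * pi * t.
  by apply: cvgM; [exact: cvg_cst|exact: cvg_id].
have cc : (fun x : R => cos (2 * pi * x)) @ t --> cos (2 * pi * t).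
  by apply: (cvg_comp _ _ ct); exact: continuous_cos.
have cs : (fun x : R => sin (2 * pi * x)) @ t --> sin (2 * pi * t).
  by apply: (cvg_comp _ _ ct); exact: continuous_sin.
move/cvgrPdist_lt/(_ _ e2) : cc => cc.
move/cvgrPdist_lt/(_ _ e2) : cs => cs.
near=> x; apply: (@le_lt_trans _ _ (`|cos (2 * pi * t) - cos (2 * pi * x)| + `|sin (2 * pi * t) - sin (2 * pi * x)|)).
  rewrite /circle_param /modulus /=.
  set u := cos _ - _; set v := sin _ - _.
  rewrite -[leRHS]ger0_norm ?addr_ge0 // -sqrtr_sqr ler_wsqrtr //.
  rewrite [leRHS]sqrrD !real_normK ?num_real // addrAC lerDl.
  by rewrite mulrn_wge0 // mulr_ge0.
by rewrite [ltRHS]splitr ltrD //; near: x.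
Unshelve. all: by end_near. Qed.

Lemma unit_circleP {R : realType} (z : CC R) :
  modulus z = 1 -> exists2 t, 0 <= t <= 1 & z = circle_param t.
Proof.
case: z => x y z1.
have /eqP := modulus_sqr (Complex x y); rewrite z1 expr1n /= eq_sym => /eqP xy.
have x2 : x ^+ 2 <= 1 by rewrite -xy lerDl sqr_ge0.
have x1 : -1 <= x <= 1 by rewrite -ler_norml -(@expr_le1 _ 2) // real_normK ?num_real.
have y2 : Num.sqrt (1 - x ^+ 2) = `|y| by rewrite -sqrtr_sqr -xy addrC addKr.
have pi2 : 0 < 2 * pi :> R by rewrite mulr_gt0 // pi_gt0.
have a0 := acos_ge0 x1; have api := acos_lepi x1.
have e1 : acos x / (2 * pi) <= 1 by rewrite ler_pdivrMr // mul1r; lra.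
have e0 : 0 <= acos x / (2 * pi) by rewrite divr_ge0 // ltW.
have eK : 2 * pi * (acos x / (2 * pi)) = acos x by rewrite mulrC divfK ?gt_eqF.
have [y0|y0] := leP 0 y.
  exists (acos x / (2 * pi)); first by rewrite e0.
  by rewrite /circle_param eK acosK // sin_acos // y2 ger0_norm.
exists (1 - acos x / (2 * pi)).
  by rewrite subr_ge0 e1 gerBl e0.
rewrite /circle_param mulrBr mulr1 eK.
have -> : 2 * pi - acos x = - acos x + pi *+ 2 by rewrite -[pi *+ 2]mulr_natl addrC.
rewrite (cosD2pi (- acos x)) (sinD2pi (- acos x)) //.
by rewrite cosN sinN acosK // sin_acos // y2 ltr0_norm // opprK.
Qed.

Lemma cvg_horner {R : realType} {T : Type} {F : set_system T} {FF : Filter F}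
    (p : {poly R[i]}) (f : T -> CC R) (l : CC R) :
  f @ F --> l -> (fun x => p.[f x] : CC R) @ F --> (p.[l] : CC R).
Proof.
move=> fl; elim/poly_ind: p => [|p c ih].
  under eq_fun do rewrite horner0; rewrite horner0; exact: cvg_cst.
under eq_fun do rewrite hornerMXaddC; rewrite hornerMXaddC.
by apply: (@cvgD _ (CC R)); [exact: (@cvgM _ T F FF _ _ _ _ ih fl)|exact: cvg_cst].
Qed.

(** * Roots of unity and the discrete Parseval identity *)

Lemma prim_root_complex (R : realType) n : (0 < n)%N ->
  exists w : R[i], n.-primitive_root w.
Proof.
move=> n0; have [rs] := closed_field_poly_normal ('X^n - 1 : {poly R[i]}).
have /monicP -> : ('X^n - 1 : {poly R[i]}) \is monic by exact: monicXnsubC.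
rewrite scale1r => E.
suff /hasP[w _ pw] : has n.-primitive_root rs by exists w.
apply: has_prim_root => //.
- by apply/allP => z; rewrite -root_prod_XsubC -E.
- by rewrite -separable_prod_XsubC -E separable_Xn_sub_1 // pnatr_eq0 -lt0n.
- by rewrite -ltnS -(size_prod_XsubC rs id) -E size_XnsubC.
Qed.

(** Orthogonality of the characters of the group of n-th roots of unity. *)
Lemma sum_prim_root (F : fieldType) n (w : F) k l :
  n.-primitive_root w -> (k < n)%N -> (l < n)%N ->
  \sum_(i < n) (w ^+ i) ^+ k / (w ^+ i) ^+ l = n%:R *+ (k == l).
Proof.
move=> pw kn ln.
have w0 : w != 0 by rewrite (prim_root_eq0 pw) -lt0n (leq_ltn_trans _ kn).
have E i : (w ^+ i) ^+ k / (w ^+ i) ^+ l = (w ^+ k / w ^+ l) ^+ i.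
  by rewrite expr_div_n -!exprM ![(i * _)%N]mulnC.
under eq_bigr do rewrite E.
have [<-|kl] := eqVneq k l.
  rewrite divff ?expf_neq0 //; under eq_bigr do rewrite expr1n.
  by rewrite sumr_const card_ord mulr1n.
set x := _ / _; have xn : x ^+ n = 1.
  by rewrite expr_div_n -!exprM ![(_ * n)%N]mulnC !exprM (prim_expr_order pw) !expr1n divr1.
have x1 : x - 1 != 0.
  rewrite subr_eq0; apply: contra kl => /eqP h.
  have /eqP : w ^+ k = w ^+ l by rewrite -[LHS](divfK (expf_neq0 l w0)) -/x h mul1r.
  by rewrite (eq_prim_root_expr pw) !modn_small.
by apply: (mulfI x1); rewrite -subrX1 xn subrr mulr0.
Qed.

Lemma prim_root_modulus (R : realType) n (w : CC R) i :
  n.-primitive_root (w : R[i]) -> modulus (w ^+ i : CC R) = 1.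
Proof.
move=> pw; rewrite modulusX.
suff -> : modulus w = 1 by rewrite expr1n.
have := prim_expr_order pw => /(congr1 (@modulus R)); rewrite modulusX modulus1.
by move/eqP; rewrite pexpr_eq1 ?(prim_order_gt0 pw) ?modulus_ge0 // => /eqP.
Qed.

Lemma conj_unit (R : realType) (z : CC R) : modulus z = 1 -> (z : R[i])^* = z^-1.
Proof. by move=> z1; rewrite invC_norm normE z1 expr1n invr1 mul1r. Qed.

Lemma modulus_sqrE (R : realType) (z : CC R) :
  (modulus z ^+ 2)%:C%C = z * (z : R[i])^* :> R[i].
Proof. by rewrite -normCK normE rmorphXn. Qed.

(** The discrete form of Parseval's identity: the monomials of degree less than n are
    orthogonal on the n-th roots of unity. *)
Lemma parseval (R : realType) n (w : R[i]) (p : {poly R[i]}) :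
  n.-primitive_root w -> (size p <= n)%N ->
  \sum_(i < n) modulus (p.[w ^+ i] : CC R) ^+ 2
    = n%:R * \sum_(k < n) modulus (p`_k : CC R) ^+ 2.
Proof.
move=> pw sp; apply: (@complexI R); rewrite rmorphM rmorph_nat !rmorph_sum /=.
have E i : (modulus (p.[w ^+ i] : CC R) ^+ 2)%:C%C =
  \sum_(k < n) \sum_(l < n) p`_k * (p`_l)^* * ((w ^+ i) ^+ k / (w ^+ i) ^+ l).
  rewrite modulus_sqrE (horner_coef_wide _ sp) rmorph_sum /= mulr_suml.
  apply: eq_bigr => k _; rewrite mulr_sumr; apply: eq_bigr => l _.
  rewrite rmorphM rmorphXn /= (@conj_unit R (w ^+ i)); last exact: prim_root_modulus pw.
  by rewrite exprVn; ring.
under eq_bigr do rewrite E.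
rewrite exchange_big mulr_sumr /=; apply: eq_bigr => k _.
rewrite exchange_big /= (bigD1 k) //= [X in _ + X]big1 ?addr0.
  by rewrite -mulr_sumr sum_prim_root // eqxx mulr1n modulus_sqrE mulrC.
move=> l lk; rewrite -mulr_sumr sum_prim_root // eq_sym.
by rewrite (_ : (l == k :> nat) = false) ?mulr0 //; apply: negbTE.
Qed.

Lemma sum_coef_le_sup (R : realType) (p : {poly R[i]}) (B : R) n :
  (forall z : CC R, modulus z = 1 -> modulus (p.[z] : CC R) <= B) ->
  \sum_(k < n) modulus (p`_k : CC R) ^+ 2 <= B ^+ 2.
Proof.
move=> pB; set N := (size p + n).+1.
have [w pw] := prim_root_complex R N isT.
apply: (@le_trans _ _ (\sum_(k < N) modulus (p`_k : CC R) ^+ 2)).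
  rewrite (@big_ord_widen _ _ _ n N (fun k => modulus (p`_k : CC R) ^+ 2)).
    by rewrite big_mkcond /=; apply: ler_sum => i _; case: ifP => // _; rewrite sqr_ge0.
  by rewrite /N; lia.
have N0 : (0 : R) < N%:R by rewrite ltr0n.
rewrite -(ler_pM2l N0) -(parseval _ _ _ _ pw); last by rewrite /N; lia.
rewrite mulr_natl -[X in _ *+ X](card_ord N) -sumr_const; apply: ler_sum => i _.
have B0 : 0 <= B by apply: le_trans (pB 1 modulus1); rewrite modulus_ge0.
by rewrite lerXn2r ?nnegrE ?modulus_ge0 //; apply: pB; apply: prim_root_modulus pw.
Qed.

Lemma coef_le_sup (R : realType) (p : {poly R[i]}) (B : R) k : 0 <= B ->
  (forall z : CC R, modulus z = 1 -> modulus (p.[z] : CC R) <= B) ->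
  modulus (p`_k : CC R) <= B.
Proof.
move=> B0 pB; rewrite -(@ler_pXn2r _ 2) ?nnegrE ?modulus_ge0 //.
apply: le_trans (sum_coef_le_sup _ _ _ k.+1 pB).
by rewrite big_ord_recr /= lerDr sumr_ge0 // => i _; rewrite sqr_ge0.
Qed.

(** On the circle conjugation is inversion, so that |z + w|^2 = (z + w)^2 / (z w):
    the even powers of |z + w| are Laurent polynomials in z. *)
Lemma unit_modulus_add (R : realType) n (z w : CC R) :
  modulus z = 1 -> modulus w = 1 ->
  (modulus (z + w : CC R) ^+ n.*2)%:C%C = (z + w) ^+ n.*2 / (z * w) ^+ n.
Proof.
move=> z1 w1; have [z0 w0] : z != 0 /\ w != 0.
  by split; [apply: contra_eq_neq z1|apply: contra_eq_neq w1] => ->;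
     rewrite modulus0 eq_sym oner_eq0.
rewrite -muln2 mulnC exprM rmorphXn /= modulus_sqrE rmorphD /= !conj_unit //.
rewrite [in RHS]exprM -expr_div_n; congr (_ ^+ n).
by field; rewrite z0 w0.
Qed.

(** In the expansion of (z + w)^2n / (z w)^n, summation over w keeps only the terms
    of degree 0 in w, that is, the central binomial coefficient: the kernel
    |z + w|^2n has total mass independent of z. *)
Lemma kernel_sum (R : realType) n (w : R[i]) (z : CC R) :
  (n.*2.+1).-primitive_root w -> modulus z = 1 ->
  \sum_(i < n.*2.+1) modulus (z + w ^+ i : CC R) ^+ n.*2 = (n.*2.+1 * 'C(n.*2, n))%:R.
Proof.
move=> pw z1; apply: (@complexI R); rewrite rmorph_sum /= rmorph_nat.
have z0 : z != 0.
  by apply: contra_eq_neq z1 => ->; rewrite modulus0 eq_sym oner_eq0.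
have E i : (modulus (z + w ^+ i : CC R) ^+ n.*2)%:C%C =
  \sum_(k < n.*2.+1) (z ^+ (n.*2 - k) / z ^+ n) *+ 'C(n.*2, k) * ((w ^+ i) ^+ k / (w ^+ i) ^+ n).
  rewrite unit_modulus_add //; last exact: prim_root_modulus pw.
  rewrite exprDn mulr_suml; apply: eq_bigr => k _.
  by rewrite exprMn invfM !mulrnAl mulrACA.
under eq_bigr do rewrite E.
have n2 : (n < n.*2.+1)%N by lia.
rewrite exchange_big /= (bigD1 (Ordinal n2)) //= [X in _ + X]big1 ?addr0.
  rewrite -mulr_sumr sum_prim_root // eqxx mulr1n.
  rewrite -addnn addnK divff ?expf_neq0 // -natrM.
  by rewrite mulnC.
move=> k kn; rewrite -mulr_sumr sum_prim_root //.
by rewrite (_ : (k == n :> nat) = false) ?mulr0 //; apply: negbTE.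
Qed.

(** The ratio of two consecutive central binomial coefficients is
    4 (2n + 1) / (2n + 2), which exceeds 4 n / (n + 1). *)
Lemma bin2n_ge n : (0 < n)%N -> (4 ^ n <= n.*2 * 'C(n.*2, n))%N.
Proof.
elim: n => // -[|n] ih _; first by [].
have {}ih := ih isT; set m := n.+1 in ih *.
have E : (m.+1 * 'C(m.+1.*2, m.+1) = 2 * m.*2.+1 * 'C(m.*2, m))%N.
  have h1 := mul_bin_diag m.*2.+2 m.
  have h2 := mul_bin_down m.*2.+1 m.
  have -> : m.+1.*2 = m.*2.+2 by [].
  rewrite /= in h1 h2.
  have h3 : (m.*2.+1 - m = m.+1)%N by lia.
  rewrite h3 in h2.
  have : (m.+1 * (m.+1 * 'C(m.*2.+2, m.+1)) = m.+1 * (2 * m.*2.+1 * 'C(m.*2, m)))%N.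
    rewrite -h1 mulnCA -h2; nia.
  by move/eqP; rewrite eqn_pmul2l // => /eqP.
rewrite expnS -doubleMl E; nia.
Qed.

(** * Density of Laurent polynomials on compact subsets of the circle *)

(** Neighbourhoods in [CC R] are defined by radii in [R[i]]; a positive element of
    [R[i]] is real, so real radii suffice. *)
Lemma near_modulusP {R : realType} (x : CC R) (P : CC R -> Prop) :
  nbhs x P <-> exists2 r : R, 0 < r & forall y : CC R, modulus (x - y : CC R) < r -> P y.
Proof.
split=> [/(@nbhs_normP R[i] (CC R) x P)[[e e'] /= e0 h]|[r r0 h]].
  move: e0; rewrite ltcE /= => /andP[/eqP ee e0]; rewrite {}ee in h.
  by exists e => // y xy; apply: h; rewrite /= normE ltcR.
apply/(@nbhs_normP R[i] (CC R) x P); exists (r%:C)%C; rewrite /= ?ltcR // => y /=.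
by rewrite normE ltcR; exact: h.
Qed.

Lemma within_modulusP {R : realType} (K : set (CC R)) (g : CC R -> CC R) :
  {within K, continuous g} -> forall x, K x -> forall e : R, 0 < e ->
  exists2 r : R, 0 < r &
    forall y, K y -> modulus (x - y : CC R) < r -> modulus (g x - g y : CC R) < e.
Proof.
move=> /subspace_continuousP cg x Kx e e0.
have h0 : nbhs x (fun y => K y -> modulus (g x - g y : CC R) < e) := iffLR (@cvg_modulus R _ (within K (nbhs x)) _ g (g x)) (cg _ Kx) _ e0.
have [r r0 h] := iffLR (near_modulusP _ _) (h0 _).
by exists r => // y Ky xy; exact: h.
Qed.

Lemma within_uniform {R : realType} (K : set (CC R)) (g : CC R -> CC R) :
  compact K -> {within K, continuous g} -> forall e : R, 0 < e ->
  exists2 d : R, 0 < d & forall x y, K x -> K y ->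
    modulus (x - y : CC R) < d -> modulus (g x - g y : CC R) < e.
Proof.
move=> /compact_near_coveringP cK /within_modulusP cg e e0.
have e2 : 0 < e / 2 by rewrite divr_gt0.
pose P (d : R) (x : CC R) := forall y, K x -> K y ->
    modulus (x - y : CC R) < d -> modulus (g x - g y : CC R) < e.
have : \forall d \near (0:R)^'+, K `<=` P d.
  apply: cK => x Kx; have [r r0 hr] := cg _ Kx _ e2.
  have r2 : 0 < r / 2 by rewrite divr_gt0.
  exists ([set y | modulus (x - y : CC R) < r / 2], [set d | d < r / 2]) => /=.
    split; last exact: nbhs_right_lt.
    by apply/near_modulusP; exists (r / 2).
  move=> -[x' d] /= [xx' dr] y Kx' Ky xy.
  have -> : g x' - g y = (g x' - g x) + (g x - g y) by rewrite addrA subrK.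
  rewrite (le_lt_trans (modulusD _ _)) // [ltRHS]splitr ltrD //.
    by rewrite modulusBC hr //; lra.
  apply: hr => //; have -> : x - y = (x - x') + (x' - y) by rewrite addrA subrK.
  by rewrite (le_lt_trans (modulusD _ _)) // [ltRHS]splitr ltrD // (lt_trans xy).
move=> h; have : \forall d \near (0:R)^'+, 0 < d /\ K `<=` P d.
  by near=> d; split; [near: d; exact: nbhs_right_gt|near: d].
by move=> /filter_ex[d [d0 hd]]; exists d => // x y Kx; exact: hd.
Unshelve. all: by end_near. Qed.

Lemma within_bounded {R : realType} (K : set (CC R)) (g : CC R -> CC R) :
  compact K -> {within K, continuous g} ->
  exists2 B : R, 0 < B & forall x, K x -> modulus (g x) <= B.
Proof.
move=> /compact_near_coveringP cK /within_modulusP cg.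
have : \forall B \near +oo%R, K `<=` [set x | K x -> modulus (g x) <= B].
  apply: (cK R _ (fun B x => K x -> modulus (g x) <= B)) => x Kx; have [r r0 hr] := cg _ Kx 1 ltr01.
  exists ([set y | modulus (x - y : CC R) < r], [set B | modulus (g x) + 1 < B]) => /=.
    split; last by apply: nbhs_pinfty_gt; rewrite num_real.
    by apply/near_modulusP; exists r.
  move=> -[x' d] /= [xx' dr] Kx'.
  have := hr _ Kx' xx'; have := modulusB_ge (g x') (g x); rewrite modulusBC; lra.
move=> h; have : \forall B \near +oo%R, 0 < B /\ K `<=` [set x | K x -> modulus (g x) <= B].
  by near=> d; split; [near: d; exact: nbhs_pinfty_gt|near: d].
by move=> /filter_ex[B [B0 hB]]; exists B => // x Kx; exact: hB.
Unshelve. all: by end_near. Qed.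

(** Since (1 - x) (1 + x/2)^2 <= 1 for 0 < x <= 1, Bernoulli's inequality gives
    (1 - x)^n = O(n^-2). *)
Lemma exists_nqn_lt {R : realType} (x C : R) : 0 < x -> x <= 1 ->
  exists2 n, (0 < n)%N & C * (n%:R * (1 - x) ^+ n) < 1.
Proof.
move=> x0 x1; set D := `|C| * 4 / x ^+ 2 + 1.
have D0 : 0 < D by rewrite ltr_wpDl // divr_ge0 ?sqr_ge0 // mulr_ge0.
exists (Num.bound D).
  rewrite lt0n; apply/eqP => h; have := archi_boundP (ltW D0).
  by rewrite h mulr0n ltNge ltW.
set n := Num.bound D; have nD : D < n%:R by apply: archi_boundP; exact: ltW.
have n0 : 0 < n%:R :> R by exact: lt_trans nD.
set q := 1 - x; have q0 : 0 <= q by rewrite subr_ge0.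
have x20 : 0 <= x / 2 by rewrite divr_ge0 // ltW.
have hq : q ^+ n * (1 + (x / 2) * n%:R) ^+ 2 <= 1.
  apply: (@le_trans _ _ (q ^+ n * ((1 + x / 2) ^+ n) ^+ 2)).
    rewrite ler_wpM2l ?exprn_ge0 // lerXn2r ?nnegrE ?exprn_ge0 ?addr_ge0 //.
      by rewrite mulr_ge0.
    elim: (n) => [|k ih]; first by rewrite mulr0 addr0 expr0.
    have h : 0 <= (x / 2) * k%:R by rewrite mulr_ge0.
    rewrite exprS (le_trans _ (ler_wpM2l _ ih)) ?addr_ge0 //.
    rewrite -[k.+1%:R]natr1 -subr_ge0 (_ : _ - _ = (x / 2) * ((x / 2) * k%:R)) ?(mulr_ge0 x20 h) //.
    by ring.
  rewrite exprAC -exprMn exprn_ile1 //; first by rewrite mulr_ge0 // sqr_ge0.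
  rewrite /q; nra.
have hx : q ^+ n * (n%:R * x ^+ 2) * n%:R <= 4.
  have qn : 0 <= q ^+ n by rewrite exprn_ge0.
  have : q ^+ n * ((x/2) * n%:R)^+2 <= 1.
    apply: le_trans hq; rewrite ler_wpM2l // lerXn2r ?nnegrE ?addr_ge0 ?lerDr ?(mulr_ge0 x20 (ltW n0)) //.
  rewrite !exprMn; have -> : 2^-1 ^+ 2 = 4^-1 :> R by field.
  lra.
have hn : `|C| * 4 < x ^+ 2 * n%:R.
  rewrite -ltr_pdivrMl ?exprn_gt0 // mulrC (lt_trans _ nD) // /D; lra.
apply: (@le_lt_trans _ _ (`|C| * (n%:R * q ^+ n))).
  by rewrite ler_wpM2r ?ler_norm // mulr_ge0 // exprn_ge0.
have x2n : 0 < x ^+ 2 * n%:R by rewrite mulr_gt0 // exprn_gt0.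
rewrite -(ltr_pM2r x2n) mul1r; apply: le_lt_trans hn.
rewrite -mulrA; apply: ler_wpM2l => //.
by rewrite (le_trans _ hx) // le_eqVlt; apply/orP; left; apply/eqP; ring.
Qed.

(** Average g against the kernel |z + w|^2n over the 2n+1-th roots of unity w.  As
    |z + w|^2 = 4 - |z - w|^2 on the circle, the kernel concentrates at z, and it
    is a Laurent polynomial in z by [unit_modulus_add].  Since g is defined on K
    only, at w it is replaced by its value at a point of K near w. *)
Lemma laurent_dense {R : realType} (K : set (CC R)) (g : CC R -> CC R) (e : R) :
  K `<=` @unit_circle R -> compact K -> {within K, continuous g} -> 0 < e ->
  exists n, exists P : {poly R[i]}, forall z, K z ->
    modulus (P.[z] / z ^+ n - g z : CC R) < e.
Proof.
move=> KT cK cg e0.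
have e2 : 0 < e / 2 by rewrite divr_gt0.
have [d0 d00 hd0] := within_uniform _ _ cK cg _ e2.
have [B B0 hB] := within_bounded _ _ cK cg.
(* Half of the modulus of continuity: z and the point of K that stands for w are
   both within d of w. *)
set d := Num.min (d0 / 2) 1; have dgt0 : 0 < d by rewrite lt_min divr_gt0 /=.
have dd : d <= d0 / 2 by rewrite ge_min lexx.
have d1 : d <= 1 by rewrite ge_min lexx orbT.
(* For |z - w| >= d the kernel is at most (4 - d^2)^n = 4^n (1 - x)^n, against a
   mass of (2n+1) 'C(2n, n). *)
pose x := d ^+ 2 / 4.
have [||n n0 hn] := exists_nqn_lt x (8 * B / e).
- by rewrite divr_gt0 // exprn_gt0.
- by rewrite /x; nra.
have [w pw] := prim_root_complex R n.*2.+1 isT.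
pose g' (v : CC R) : CC R :=
  match pselect (exists2 y, K y & modulus (y - v : CC R) < d) with
  | left h => g (projT1 (cid2 h)) | right _ => 0 end.
have g'B v : modulus (g' v) <= B.
  rewrite /g'; case: pselect => [h|_]; last by rewrite modulus0 ltW.
  by case: cid2 => y Ky _ /=; exact: hB.
have g'd v z : K z -> modulus (z - v : CC R) < d -> modulus (g' v - g z : CC R) < e / 2.
  move=> Kz zv; rewrite /g'; case: pselect => [h|[]]; last by exists z.
  case: cid2 => y Ky yv /=; apply: hd0 => //.
  have -> : y - z = (y - v) - (z - v) by rewrite opprB addrA subrK.
  by rewrite (le_lt_trans (modulusB _ _)) //; lra.
set N := n.*2.+1 in pw *; set c : R := (N * 'C(n.*2, n))%:R.
have c0 : 0 < c by rewrite ltr0n muln_gt0 bin_gt0 -addnn leq_addr.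
pose P : {poly R[i]} := \sum_(i < N) (g' (w ^+ i) / (w ^+ i) ^+ n / (c%:C)%C) *: ('X + (w ^+ i)%:P) ^+ n.*2.
have cge0 := ltW c0; have B0' := ltW B0; have e2' := ltW e2.
exists n, P => z Kz; have z1 : modulus z = 1 := KT _ Kz.
pose k i : R := modulus (z + w ^+ i : CC R) ^+ n.*2.
have k0 i : 0 <= k i by rewrite exprn_ge0 // modulus_ge0.
have sk : \sum_(i < N) k i = c by exact: kernel_sum.
have wi i : modulus (w ^+ i : CC R) = 1 by apply: prim_root_modulus pw.
have cC0 : (c%:C)%C != 0 :> R[i] by rewrite (inj_eq (@complexI R)) gt_eqF.
have E : P.[z] / z ^+ n - g z = \sum_(i < N) (k i / c)%:C%C * (g' (w ^+ i) - g z) :> R[i].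
  under [RHS]eq_bigr do rewrite mulrBr.
  rewrite sumrB -mulr_suml -rmorph_sum /= -mulr_suml sk divff ?gt_eqF // mul1r.
  congr (_ - _); rewrite horner_sum mulr_suml; apply: eq_bigr => i _.
  rewrite !hornerE rmorphM fmorphV /= /k unit_modulus_add // exprMn invfM.
  ring.
have far i : d <= modulus (z - w ^+ i : CC R) -> k i <= 4 ^+ n * (1 - x) ^+ n.
  move=> zw; rewrite /k -muln2 mulnC exprM -exprMn lerXn2r ?nnegrE ?sqr_ge0 //.
    by rewrite /x; nra.
  have := parallelogram z (w ^+ i); rewrite z1 wi expr1n /x.
  have : d ^+ 2 <= modulus (z - w ^+ i : CC R) ^+ 2 by rewrite lerXn2r ?nnegrE ?modulus_ge0 // ltW.
  lra.
rewrite E; apply: le_lt_trans (modulus_sum _ _ _ _) _.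
(* Both the near part and the far part of the error are nonnegative, so each
   term is bounded by the sum of the two estimates. *)
apply: (@le_lt_trans _ _ (\sum_(i < N) (k i / c * (e / 2) + 4 ^+ n * (1 - x) ^+ n / c * (2 * B)))).
  apply: ler_sum => i _; rewrite modulusM modulus_real ger0_norm ?divr_ge0 //.
  have x0 : 0 <= 1 - x by rewrite /x; nra.
  have q0 : 0 <= 4 ^+ n * (1 - x) ^+ n by rewrite mulr_ge0 ?exprn_ge0.
  have [zw|zw] := ltP (modulus (z - w ^+ i : CC R)) d.
    apply: ler_wpDr; first by apply: mulr_ge0; rewrite ?divr_ge0 // mulr_ge0.
    by rewrite ler_wpM2l ?divr_ge0 // ltW // g'd.
  apply: ler_wpDl; first by apply: mulr_ge0 => //; exact: divr_ge0.
  apply: ler_pM; rewrite ?divr_ge0 ?modulus_ge0 //.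
    by rewrite ler_wpM2r ?invr_ge0 ?far.
  by rewrite (le_trans (modulusB _ _)) // mulrDl mul1r lerD ?hB.
rewrite big_split /= -[X in X + _]mulr_suml -[X in X * _ + _]mulr_suml sk divff ?gt_eqF // mul1r.
rewrite sumr_const card_ord [ltRHS]splitr ltrD2l -[X in X < _]mulr_natl.
have b0 : 0 < ('C(n.*2, n))%:R :> R by rewrite ltr0n bin_gt0 -addnn leq_addr.
have hb : 4 ^+ n <= n.*2%:R * ('C(n.*2, n))%:R :> R by rewrite -natrX -natrM ler_nat bin2n_ge.
have N0 : (0 : R) < N%:R by rewrite ltr0n.
rewrite /c natrM.
have -> : N%:R * (4 ^+ n * (1 - x) ^+ n / (N%:R * 'C(n.*2, n)%:R) * (2 * B)) =
  4 ^+ n / 'C(n.*2, n)%:R * ((1 - x) ^+ n * (2 * B)) by field; rewrite !gt_eqF.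
have hb' : 4 ^+ n / ('C(n.*2, n))%:R <= n%:R * 2 :> R by rewrite ler_pdivrMr // -natrM muln2.
have x0 : 0 <= 1 - x by rewrite /x; nra.
have y0 : 0 <= (1 - x) ^+ n * (2 * B) by rewrite mulr_ge0 ?exprn_ge0 // mulr_ge0 // ltW.
apply: le_lt_trans (ler_wpM2r y0 hb') _.
have := hn; rewrite mulrAC ltr_pdivrMr // mul1r; lra.
Qed.

(** * Means over the circle *)

Definition mean {R : realType} (h : R -> R) : R :=
  Rintegral (@lebesgue_measure R) `[0, 1] h.

Lemma continuous_integrable01 {R : realType} (h : R -> R) :
  continuous h -> (@lebesgue_measure R).-integrable `[0, 1] (EFin \o h).
Proof.
move=> ch; apply: continuous_compact_integrable; first exact: segment_compact.
exact: continuous_subspaceT.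
Qed.

Lemma meanD {R : realType} (h k : R -> R) : continuous h -> continuous k ->
  mean (fun t => h t + k t) = mean h + mean k.
Proof. by move=> ch ck; rewrite /mean RintegralD //; exact: continuous_integrable01. Qed.

Lemma meanZ {R : realType} (c : R) (h : R -> R) : continuous h ->
  mean (fun t => c * h t) = c * mean h.
Proof. by move=> ch; rewrite /mean RintegralZl //; exact: continuous_integrable01. Qed.

Lemma mean_cst {R : realType} (c : R) : mean (fun=> c) = c.
Proof.
rewrite /mean Rintegral_cst //= lebesgue_measure_itv /= lte01.
by rewrite -EFinB subr0 /= mulr1.
Qed.

Lemma le_mean {R : realType} (h k : R -> R) : continuous h -> continuous k ->
  (forall t, h t <= k t) -> mean h <= mean k.
Proof.
by move=> ch ck hk; apply: le_Rintegral => //; exact: continuous_integrable01.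
Qed.

(** Markov's inequality. *)
Lemma measure_le_mean {R : realType} (A : set R) (h : R -> R) :
  measurable A -> A `<=` `[0, 1] -> continuous h -> (forall t, 0 <= h t) ->
  (forall t, A t -> 1 <= h t) -> (lebesgue_measure A <= (mean h)%:E)%E.
Proof.
move=> mA A01 ch h0 h1.
have ih := continuous_integrable01 _ ch.
have m01 : measurable (`[0, 1] : set R) by [].
have mh := measurable_int _ ih.
rewrite /mean /Rintegral fineK; last exact: integrable_fin_num.
rewrite -[X in (X <= _)%E]mul1e -integral_cst //.
apply: (@le_trans _ _ (\int[lebesgue_measure]_(t in A) (h t)%:E)%E); last first.
  by apply: ge0_subset_integral => // t _; rewrite lee_fin.
apply: ge0_le_integral => //.
exact: (measurable_funS m01).
Qed.

(** * A superharmonic potential *)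

(** The product of w + b, w - b, w + ib and w - ib is w^4 - b^4: the average of
    ln |.| over the four rotations differs from ln |w| only at the fourth order
    in b / w, which reflects that ln |.| is harmonic. *)
Lemma ln_rotations {R : realType} (w b : CC R) :
  modulus b < modulus w ->
  ln (modulus (w + b : CC R)) + ln (modulus (w - b : CC R)) +
  (ln (modulus (w + Complex 0 1 * b : CC R)) + ln (modulus (w - Complex 0 1 * b : CC R)))
  <= 4 * ln (modulus w) + (modulus b / modulus w) ^+ 4.
Proof.
move=> bw; have w0 : 0 < modulus w := le_lt_trans (modulus_ge0 b) bw.
have i1 : modulus (Complex 0 1 : CC R) = 1.
  by rewrite /modulus /= expr0n /= add0r expr1n sqrtr1.
have pos (c : CC R) : modulus c = modulus b -> 0 < modulus (w + c : CC R) /\ 0 < modulus (w - c : CC R).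
  move=> cb; have := modulusB_ge w (- c); have := modulusB_ge w c.
  by rewrite modulusN opprK cb; lra.
have [p1 p2] := pos b erefl; have [|p3 p4] := pos (Complex 0 1 * b); first by rewrite modulusM i1 mul1r.
rewrite -!lnM ?posrE ?mulr_gt0 // -!modulusM.
have -> : (w + b) * (w - b) * ((w + Complex 0 1 * b) * (w - Complex 0 1 * b)) = w ^+ 4 - b ^+ 4 :> R[i].
  have i2 : (Complex 0 1 : R[i]) ^+ 2 = -1 by exact: sqr_i.
  rewrite [LHS](_ : _ = (w ^+ 2 - b ^+ 2) * (w ^+ 2 - Complex 0 1 ^+ 2 * b ^+ 2)); last by ring.
  by rewrite i2; ring.
set rho := _ / _.
have le4 : modulus (w ^+ 4 - b ^+ 4 : CC R) <= modulus w ^+ 4 * (1 + rho ^+ 4).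
  rewrite (le_trans (modulusB _ _)) // !modulusX mulrDr mulr1 lerD2l.
  by rewrite /rho expr_div_n mulrC divfK // expf_neq0 // gt_eqF.
have gt4 : 0 < modulus (w ^+ 4 - b ^+ 4 : CC R).
  apply: lt_le_trans (modulusB_ge _ _); rewrite !modulusX subr_gt0.
  by rewrite ltrXn2r ?nnegrE ?modulus_ge0.
have r4 : 0 <= rho ^+ 4 by rewrite exprn_ge0 // divr_ge0 // modulus_ge0.
have w4 : 0 < modulus w ^+ 4 by rewrite exprn_gt0.
have r41 : 0 < 1 + rho ^+ 4 by rewrite ltr_pwDl.
apply: (@le_trans _ _ (ln (modulus w ^+ 4 * (1 + rho ^+ 4)))).
  by rewrite ler_ln ?posrE // mulr_gt0.
rewrite lnM ?posrE // lnXn // mulr_natl lerD2l le_ln1Dx //; lra.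
Qed.

(** As a function of w in the plane, with m = |w|: the logarithm is harmonic, and
    the quadratic term makes the potential strictly superharmonic. *)
Definition potential {R : realType} (beta : R) (m : R) : R := ln m - beta * m ^+ 2.

(** The quadratic term loses exactly beta |b|^2 on average over the four rotations;
    the bound on b lets half of this loss absorb the error of [ln_rotations]. *)
Lemma potential_rotations {R : realType} (w b : CC R) (r beta : R) :
  0 < r -> r < modulus w -> modulus b < r -> modulus b ^+ 2 <= 2 * beta * r ^+ 4 ->
  potential beta (modulus (w + b : CC R)) + potential beta (modulus (w - b : CC R)) +
  (potential beta (modulus (w + Complex 0 1 * b : CC R)) +
   potential beta (modulus (w - Complex 0 1 * b : CC R)))
  <= 4 * potential beta (modulus w) - 2 * beta * modulus b ^+ 2.
Proof.
move=> r0 rw br bb; rewrite /potential.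
have i1 : modulus (Complex 0 1 * b : CC R) = modulus b.
  by rewrite modulusM /modulus /= expr0n /= add0r expr1n sqrtr1 mul1r.
have w0 : 0 < modulus w by exact: lt_trans rw.
have h1 := parallelogram w b; have h2 := parallelogram w (Complex 0 1 * b).
rewrite i1 in h2; have h3 := ln_rotations w b (lt_trans br rw).
have h4 : (modulus b / modulus w) ^+ 4 <= 2 * beta * modulus b ^+ 2.
  rewrite expr_div_n ler_pdivrMr ?exprn_gt0 //.
  rewrite [X in X <= _](_ : _ = modulus b ^+ 2 * modulus b ^+ 2); last by ring.
  rewrite [X in _ <= X](_ : _ = (2 * beta * modulus w ^+ 4) * modulus b ^+ 2); last by ring.
  rewrite ler_wpM2r ?exprn_ge0 ?modulus_ge0 //.
  have b0 : 0 <= 2 * beta.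
    have := le_trans (sqr_ge0 _) bb; rewrite pmulr_lge0 //; exact: exprn_gt0.
  apply: le_trans bb _.
  by rewrite ler_wpM2l // lerXn2r ?nnegrE ?modulus_ge0 // ltW.
move: h1 h2 h3 h4; set x1 := modulus (w + b); set x2 := modulus (w - b).
set x3 := modulus (w + _); set x4 := modulus (w - _).
move: (ln x1) (ln x2) (ln x3) (ln x4) (ln _) => l1 l2 l3 l4 l5.
move: (x1 ^+ 2) (x2 ^+ 2) (x3 ^+ 2) (x4 ^+ 2) (_ ^+ 4) => y1 y2 y3 y4 y5 h1 h2 h3 h4.
have e1 : beta * (y1 + y2) = beta * (2 * (modulus w ^+ 2 + modulus b ^+ 2)) by rewrite h1.
have e2 : beta * (y3 + y4) = beta * (2 * (modulus w ^+ 2 + modulus b ^+ 2)) by rewrite h2.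
lra.
Qed.

(** * Perturbations of a polynomial inside an annulus *)

Lemma circle_image_compact {R : realType} (A : set R) :
  compact A -> compact (@circle_param R @` A : set (CC R)).
Proof.
move=> cA; apply: continuous_compact => //.
by apply: continuous_subspaceT; exact: circle_param_continuous.
Qed.

Lemma unit_circle_compact {R : realType} : compact (@unit_circle R : set (CC R)).
Proof.
have -> : (@unit_circle R) = @circle_param R @` `[0, 1].
  apply/seteqP; split=> [z /unit_circleP[t t01 ->]|z [t _ <-]].
    by exists t => //=; rewrite in_itv.
  exact: circle_param_unit.
by apply: circle_image_compact; exact: segment_compact.
Qed.

Lemma horner_continuous {R : realType} (p : {poly R[i]}) :
  continuous (fun z : CC R => p.[z] : CC R).
Proof. by move=> z; apply: (@cvg_horner _ _ (nbhs (z : CC R)) _ p id z); exact: cvg_id. Qed.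

Lemma modulus_horner_continuous {R : realType} (p : {poly R[i]}) :
  continuous (fun z : CC R => modulus (p.[z] : CC R)).
Proof.
move=> z; apply: (@continuous_comp _ _ _ (fun z : CC R => p.[z] : CC R) (@modulus R)).
  exact: horner_continuous.
exact: modulus_continuous.
Qed.

Lemma circle_horner_continuous {R : realType} (p : {poly R[i]}) :
  continuous (fun t : R => modulus (p.[circle_param t] : CC R)).
Proof.
move=> t; apply: (@continuous_comp _ _ _ (@circle_param R) (fun z : CC R => modulus (p.[z] : CC R))).
  exact: circle_param_continuous.
exact: modulus_horner_continuous.
Qed.

(** The polynomials that the moves can reach from the constant 1: the vanishing of
    the coefficients 1, ..., N-1 makes 1 - F divisible by X^N, and the bound a on
    the others is the flatness required of 1 - F. *)
Definition admissible {R : realType} (a r M : R) (N : nat) (F : {poly R[i]}) : Prop :=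
  [/\ F`_0 = 1,
      (forall k, (0 < k < N)%N -> F`_k = 0),
      (forall k, (0 < k)%N -> modulus (F`_k : CC R) <= a) &
      (forall z : CC R, modulus z = 1 -> r < modulus (F.[z] : CC R) < M)].

(** The distance from the circle |w| = m to the boundary of the annulus
    r < |w| < M, capped at a. *)
Definition gap {R : realType} (a r M m : R) : R := Num.min a (Num.min (m - r) (M - m)).

Lemma gap_continuous {R : realType} (a r M : R) : continuous (gap a r M).
Proof.
move=> m.
have -> : gap a r M = (fun=> a) \min ((fun m => m - r) \min (fun m => M - m)) by [].
apply: continuous_min; first exact: cvg_cst.
apply: continuous_min.
  by apply: cvgB; [exact: cvg_id|exact: cvg_cst].
by apply: cvgB; [exact: cvg_cst|exact: cvg_id].
Qed.

Lemma real_complex_continuous {R : realType} :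
  continuous (fun x : R => (x%:C)%C : CC R).
Proof.
move=> x; apply/cvg_modulus => e e0.
apply: filterS (@nbhsx_ballx R R x e e0) => y /=.
by rewrite /ball /=; rewrite -rmorphB modulus_real.
Qed.

(** The moves.  On the circle |X^s * P| = |P|, so P only has to be a Laurent
    approximation, up to a power of z, of half the gap of F, with a relative
    error of one half: it then moves F by less than its distance to the
    boundary.  The coefficients of P are bounded by its maximum on the circle. *)
Lemma exists_perturbation {R : realType} (a r M : R) N F :
  0 < a -> admissible a r M N F ->
  exists D : {poly R[i]},
    (forall c : CC R, modulus c = 1 -> admissible a r M N (F + c *: D)) /\
    (forall z : CC R, modulus z = 1 ->
       gap a r M (modulus (F.[z] : CC R)) / 4 <= modulus (D.[z] : CC R) <= a).
Proof.
move=> a0 [F0 FN Fa FrM].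
pose G (z : CC R) : R := gap a r M (modulus (F.[z] : CC R)).
have G0 (z : CC R) : modulus z = 1 -> 0 < G z.
  by move=> /FrM/andP[h1 h2]; rewrite /G /gap !lt_min a0 !subr_gt0 h1.
have cG : continuous G.
  move=> z; apply: (@continuous_comp _ _ _ (fun z : CC R => modulus (F.[z] : CC R)) (gap a r M)).
    exact: modulus_horner_continuous.
  exact: gap_continuous.
have [z0 z01 hz0] := @compact_EVT_min _ _ G _ (ex_intro _ 1 modulus1) (@unit_circle_compact R) (continuous_subspaceT cG).
rewrite inE in z01; set c := G z0 in hz0; have c0 : 0 < c by exact: G0.
have cle z : modulus z = 1 -> c <= G z by move=> z1; apply: hz0; rewrite inE.
have cG2 : {within @unit_circle R, continuous (fun z => (G z / 2)%:C%C : CC R)}.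
  apply: continuous_subspaceT => z.
  apply: (@continuous_comp _ _ _ (fun z => G z / 2) (fun x => (x%:C)%C : CC R)); last first.
    exact: real_complex_continuous.
  by apply: (@cvgM _ _ (nbhs (z : CC R)) _ G (fun=> 2^-1)); [exact: cG|exact: cvg_cst].
have c4 : 0 < c / 4 by rewrite divr_gt0.
have [n [P hP]] := laurent_dense _ _ _ (fun z h => h) unit_circle_compact cG2 c4.
have hPz (z : CC R) : modulus z = 1 -> G z / 4 <= modulus (P.[z] : CC R) <= 3 / 4 * G z.
  move=> z1; have := hP z z1; have := cle z z1.
  have -> : modulus (P.[z] : CC R) = modulus (P.[z] / z ^+ n : CC R).
    by rewrite modulusM modulusV modulusX z1 expr1n invr1 mulr1.
  set x : CC R := P.[z] / _; set y : CC R := (G z / 2)%:C%C.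
  have yG : modulus y = G z / 2 by rewrite modulus_real ger0_norm // divr_ge0 // ltW // G0.
  move=> h1 h2; have := modulusB_ge x y; have := modulusB_ge y x.
  by rewrite (modulusBC y x) yG => h3 h4; apply/andP; split; lra.
have Ga z : G z <= a by rewrite /G /gap ge_min lexx.
have Pa (z : CC R) : modulus z = 1 -> modulus (P.[z] : CC R) <= a.
  move=> z1; have /andP[_] := hPz z z1; have := Ga z; have := G0 z z1; lra.
pose s := (N + size F).+1.
have Dz (z : CC R) : modulus z = 1 -> modulus (('X^s * P).[z] : CC R) = modulus (P.[z] : CC R).
  by move=> z1; rewrite hornerM hornerXn modulusM modulusX z1 expr1n mul1r.
exists ('X^s * P); split=> [u u1|z z1]; last first.
  by rewrite Dz // Pa // andbT; have /andP[] := hPz z z1.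
have DE k : (F + u *: ('X^s * P))`_k = if (k < s)%N then F`_k else u * P`_(k - s).
  rewrite coefD coefZ coefXnM; case: ltnP => ks; first by rewrite mulr0 addr0.
  by rewrite nth_default ?add0r // (leq_trans _ ks) // leqW // leq_addl.
split.
- by rewrite DE /=.
- by move=> k /andP[k0 kN]; rewrite DE ifT ?FN ?k0 // ltnS (leq_trans (ltnW kN)) // leq_addr.
- move=> k k0; rewrite DE; case: ifP => _; first exact: Fa.
  by rewrite modulusM u1 mul1r; apply: coef_le_sup => //; exact: ltW.
- move=> z z1; rewrite hornerD hornerZ.
  have D1 : modulus (u * ('X^s * P).[z] : CC R) = modulus (P.[z] : CC R).
    by rewrite modulusM u1 mul1r Dz.
  have /andP[_] := hPz z z1; rewrite -D1; set d : CC R := _ * _.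
  have := G0 z z1; have : G z <= modulus (F.[z] : CC R) - r.
    by rewrite /G /gap !ge_min lexx orbT.
  have : G z <= M - modulus (F.[z] : CC R).
    by rewrite /G /gap !ge_min lexx !orbT.
  have := modulusD F.[z] d; have := modulusB_ge F.[z] (- d); rewrite modulusN opprK.
  by move=> *; apply/andP; split; lra.
Qed.

(** * Flat polynomials close to 1 *)

Lemma ln_circle_continuous {R : realType} (F : {poly R[i]}) :
  (forall z : CC R, modulus z = 1 -> 0 < modulus (F.[z] : CC R)) ->
  continuous (fun t : R => ln (modulus (F.[circle_param t] : CC R))).
Proof.
move=> F0 t; apply: (@continuous_comp _ _ _ (fun t : R => modulus (F.[circle_param t] : CC R)) (@ln R)).
  exact: circle_horner_continuous.
by apply: continuous_ln; apply: F0; exact: circle_param_unit.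
Qed.

Lemma sqr_circle_continuous {R : realType} (F : {poly R[i]}) :
  continuous (fun t : R => modulus (F.[circle_param t] : CC R) ^+ 2).
Proof.
by move=> t; apply: (@cvgM _ _ (nbhs t)); exact: circle_horner_continuous.
Qed.

Lemma potential_circle_continuous {R : realType} (beta : R) (F : {poly R[i]}) :
  (forall z : CC R, modulus z = 1 -> 0 < modulus (F.[z] : CC R)) ->
  continuous (fun t : R => potential beta (modulus (F.[circle_param t] : CC R))).
Proof.
move=> F0 t; apply: (@cvgB _ _ _ (nbhs t)); first exact: ln_circle_continuous.
by apply: (@cvgM _ _ (nbhs t)); [exact: cvg_cst|exact: sqr_circle_continuous].
Qed.

Lemma admissible_gt0 {R : realType} (a r M : R) N F :
  0 < r -> admissible a r M N F ->
  forall z : CC R, modulus z = 1 -> 0 < modulus (F.[z] : CC R).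
Proof. by move=> r0 [_ _ _ h] z /h /andP[+ _]; exact: lt_trans. Qed.

Lemma fun_continuousD {R : realType} (h k : R -> R) :
  continuous h -> continuous k -> continuous (fun t => h t + k t).
Proof. by move=> ch ck t; apply: (@cvgD _ _ _ (nbhs t)); [exact: ch|exact: ck]. Qed.

Lemma fun_continuousZ {R : realType} (c : R) (h : R -> R) :
  continuous h -> continuous (fun t => c * h t).
Proof. by move=> ch t; apply: (@cvgM _ _ (nbhs t)); [exact: cvg_cst|exact: ch]. Qed.

(** Let F be an almost minimizer of the mean potential among the admissible
    polynomials.  The four moves c = 1, -1, i, -i stay admissible, hence cannot
    bring the mean below the infimum, while by [potential_rotations] they lower
    it on average by a multiple of the mean of |D|^2: so this mean is small.
    The constant 1 is admissible with potential -beta, which bounds the mean of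
    ln |F|. *)
Lemma near_extremal {R : realType} (a r M kappa : R) N :
  0 < r -> r < 1 -> 1 < M -> 0 < a -> a <= r ^+ 2 / M -> 0 < kappa ->
  exists F, exists D : {poly R[i]}, [/\ admissible a r M N F,
    forall z : CC R, modulus z = 1 ->
      gap a r M (modulus (F.[z] : CC R)) / 4 <= modulus (D.[z] : CC R),
    mean (fun t => modulus (D.[circle_param t] : CC R) ^+ 2) <= kappa &
    mean (fun t => ln (modulus (F.[circle_param t] : CC R))) <= kappa + 1].
Proof.
move=> r0 r1 M1 a0 ar k0.
have M0 : 0 < M by exact: lt_trans M1.
(* With this beta the quadratic term stays below 1/2 on the annulus, and the bound
   on a is the hypothesis on b in potential_rotations. *)
pose beta : R := (2 * M ^+ 2)^-1.
have b0 : 0 < beta by rewrite invr_gt0 mulr_gt0 // exprn_gt0.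
have b1 : beta <= 1 / 2.
  by rewrite /beta invfM mul1r ler_piMr ?invr_ge0 // invf_le1 ?exprn_gt0 // exprn_ege1 // ltW.
have bM : beta * M ^+ 2 = 1 / 2.
  by rewrite /beta; field; rewrite gt_eqF.
have a_r : a < r.
  apply: le_lt_trans ar _; rewrite ltr_pdivrMr // expr2 ltr_pM2l //; exact: lt_trans M1.
have a2 : a ^+ 2 <= 2 * beta * r ^+ 4.
  have -> : 2 * beta * r ^+ 4 = (r ^+ 2 / M) ^+ 2 by rewrite /beta; field; rewrite gt_eqF.
  by rewrite lerXn2r ?nnegrE // ?divr_ge0 ?sqr_ge0 // ltW.
pose V F := mean (fun t : R => potential beta (modulus (F.[circle_param t] : CC R))).
pose S : set R := [set V F | F in admissible a r M N].
have lS : lbound S (ln r - 1 / 2).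
  move=> _ [F hF <-]; rewrite -[leLHS]mean_cst; apply: le_mean.
  - by move=> t; exact: cvg_cst.
  - by apply: potential_circle_continuous; exact: admissible_gt0 hF.
  move=> t; have [_ _ _ /(_ _ (circle_param_unit t)) /andP[h1 h2]] := hF.
  rewrite /potential lerB //; first by rewrite ler_ln ?posrE ?ltW // (lt_trans r0).
  by rewrite -bM ler_wpM2l ?(ltW b0) // lerXn2r ?nnegrE ?modulus_ge0 // ltW.
have adm1 : admissible a r M N 1.
  split=> [|k /andP[k0' _]|k k0'|z _].
  - by rewrite coef1.
  - by rewrite coef1 gtn_eqF.
  - by rewrite coef1 gtn_eqF // modulus0 ltW.
  - by rewrite hornerE modulus1 r1.
have V1 : V 1 = - beta.
  rewrite /V -[RHS]mean_cst; congr mean; apply/funext => t.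
  by rewrite /potential hornerE modulus1 ln1 expr1n mulr1 sub0r.
have nS : S !=set0 by exists (V 1); exists 1.
have hlS : has_lbound S by exists (ln r - 1 / 2).
have bk : 0 < beta * kappa / 2 by rewrite divr_gt0 // mulr_gt0.
have [_ [F hF <-] hVF] := inf_adherent bk (conj nS hlS).
have VF1 : V F <= - beta + beta * kappa / 2.
  by rewrite (le_trans (ltW hVF)) // lerD2r -V1 ge_inf //; exists 1.
have [D [hD Dgap]] := exists_perturbation a r M N F a0 hF.
have Fpos := admissible_gt0 _ _ _ _ _ r0 hF.
have cVF := potential_circle_continuous beta F Fpos.
have i1 : modulus (Complex 0 1 : CC R) = 1.
  by rewrite /modulus /= expr0n /= add0r expr1n sqrtr1.
have IV (c : CC R) : modulus c = 1 -> inf S <= V (F + c *: D).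
  by move=> c1; apply: ge_inf => //; exists (F + c *: D) => //; exact: hD.
have cV (c : CC R) : modulus c = 1 ->
    continuous (fun t : R => potential beta (modulus ((F + c *: D).[circle_param t] : CC R))).
  by move=> c1; apply: potential_circle_continuous; apply: admissible_gt0 (hD _ c1).
have m1 : modulus (-1 : CC R) = 1 by rewrite modulusN modulus1.
have mi : modulus (- Complex 0 1 : CC R) = 1 by rewrite modulusN i1.
have cD2 := sqr_circle_continuous D.
have key : 4 * inf S <= 4 * V F - 2 * beta * mean (fun t => modulus (D.[circle_param t] : CC R) ^+ 2).
  apply: (@le_trans _ _ ((V (F + 1 *: D) + V (F + (-1) *: D)) +
     (V (F + (Complex 0 1 : R[i]) *: D) + V (F + (- Complex 0 1 : R[i]) *: D)))).
    have := IV _ (modulus1); have := IV _ m1; have := IV _ i1; have := IV _ mi; lra.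
  have c1 := cV _ modulus1; have c2 := cV _ m1; have c3 := cV _ i1; have c4 := cV _ mi.
  have c12 := fun_continuousD _ _ c1 c2; have c34 := fun_continuousD _ _ c3 c4.
  have c4V := fun_continuousZ 4 _ cVF; have cbD := fun_continuousZ (- (2 * beta)) _ cD2.
  rewrite /V -(meanD _ _ c1 c2) -(meanD _ _ c3 c4) -(meanD _ _ c12 c34) -(meanZ _ _ cVF).
  rewrite -mulNr -(meanZ _ _ cD2) -(meanD _ _ c4V cbD).
  apply: le_mean; [exact: fun_continuousD|exact: fun_continuousD|].
  move=> t; have e1 := circle_param_unit t.
  have [_ _ _ /(_ _ e1) /andP[h1 h2]] := hF.
  have /andP[_ Da] := Dgap _ e1.
  rewrite !hornerD !hornerZ mul1r mulN1r !mulNr.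
  apply: potential_rotations r0 h1 _ _; first exact: le_lt_trans Da a_r.
  by apply: le_trans a2; rewrite lerXn2r ?nnegrE ?modulus_ge0 // ltW.
exists F, D; split=> //.
- by move=> z /Dgap/andP[].
- rewrite -(ler_pM2l b0). lra.
- have : mean (fun t => ln (modulus (F.[circle_param t] : CC R))) <= V F + 1 / 2.
    rewrite -[X in _ + X]mean_cst -meanD //; last by move=> t; exact: cvg_cst.
    apply: le_mean.
    - exact: ln_circle_continuous.
    - by move=> t; apply: (@cvgD _ _ _ (nbhs t)); [exact: cVF|exact: cvg_cst].
    move=> t; have [_ _ _ /(_ _ (circle_param_unit t)) /andP[h1 h2]] := hF.
    rewrite /potential -addrA lerDl addrC subr_ge0 -bM ler_wpM2l ?(ltW b0) //.
    by rewrite lerXn2r ?nnegrE ?modulus_ge0 // ltW.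
  have : beta * kappa <= 1 / 2 * kappa by rewrite ler_wpM2r // ltW.
  lra.
Qed.

Definition far_from_1 {R : realType} (e : R) (p : {poly R[i]}) : set R :=
  `[0, 1] `&` [set t | e < modulus (p.[circle_param t] - 1 : CC R)].

Lemma far_from_1_open {R : realType} (e : R) (p : {poly R[i]}) :
  open [set t : R | e < modulus (p.[circle_param t] - 1 : CC R)].
Proof.
have c : continuous (fun t : R => modulus ((p - 1).[circle_param t] : CC R)).
  exact: circle_horner_continuous.
have -> : [set t : R | e < modulus (p.[circle_param t] - 1 : CC R)] =
    (fun t : R => modulus ((p - 1).[circle_param t] : CC R)) @^-1` [set x | e < x].
  by apply/seteqP; split=> t /=; rewrite !hornerE.
by apply: open_comp; [move=> t _; exact: c|exact: open_gt].
Qed.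

Lemma far_from_1_measurable {R : realType} (e : R) (p : {poly R[i]}) :
  measurable (far_from_1 e p).
Proof. by apply: measurableI => //; apply: measurable_realfun.open_measurable; exact: far_from_1_open. Qed.

(** With F from [near_extremal], p = 1 - F is far from 1 where |F| > 2r.  At such a
    point either |F| >= M / 2, which is rare because the mean of ln |F| is bounded
    and M is large, or the gap is a, which is rare because the mean of |D|^2 is
    small.  The order of the quantifiers is what matters: the bound M is fixed
    before the size a of the coefficients. *)
Lemma exists_flat_near_1 {R : realType} (e delta : R) : 0 < e -> 0 < delta ->
  exists2 M : R, 0 < M & forall (a : R) N, 0 < a ->
  exists p : {poly R[i]}, [/\ forall k, (k < N)%N -> p`_k = 0,
    forall k, modulus (p`_k : CC R) <= a,
    forall z : CC R, modulus z = 1 -> modulus (p.[z] : CC R) <= M &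
    (lebesgue_measure (far_from_1 e p) <= delta%:E)%E].
Proof.
move=> e0 d0; pose r := Num.min e 1 / 2.
have r0 : 0 < r by rewrite divr_gt0 // lt_min e0 /=.
have re : 2 * r <= e by rewrite /r mulrC divfK // ge_min lexx.
have r1 : 2 * r <= 1 by rewrite /r mulrC divfK // ge_min lexx orbT.
pose d := Num.min delta 1.
have d1 : d <= 1 by rewrite ge_min lexx orbT.
have dd : d <= delta by rewrite ge_min lexx.
have dp : 0 < d by rewrite lt_min d0 /=.
have lnr : ln r < 0 by apply: ln_lt0; apply/andP; split=> //; lra.
(* M is such that ln (M / 2) - ln r = Y, and Y is 2 / d times the bound on the mean
   of ln |F| - ln r. *)
pose Y := 2 * (2 - ln r) / d.
have Y1 : - ln r <= Y by rewrite /Y ler_pdivlMr //; nra.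
have Y0 : 0 < Y by rewrite (lt_le_trans _ Y1) // oppr_gt0.
pose M := 2 * (r * expR Y).
have rY : 1 <= r * expR Y.
  have -> : 1 = r * expR (- ln r) by rewrite expRN lnK ?posrE // divff // gt_eqF.
  by rewrite ler_pM2l // ler_expR.
have rY' : r <= r * expR Y by rewrite ler_peMr ?(ltW r0) // -expR0 ler_expR ltW.
exists (1 + M); first by rewrite /M; lra.
move=> a' N a'0; pose a := Num.min a' (r ^+ 2 / M).
have M0 : 0 < M by rewrite /M; lra.
have a0 : 0 < a by rewrite lt_min a'0 divr_gt0 // exprn_gt0.
have aa' : a <= a' by rewrite ge_min lexx.
have aM : a <= r ^+ 2 / M by rewrite ge_min lexx orbT.
have ar : a <= r.
  by apply: le_trans aM _; rewrite ler_pdivrMr // expr2 ler_pM2l // /M; lra.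
pose kappa := Num.min 1 (a ^+ 2 * d / 32).
have k1 : kappa <= 1 by rewrite ge_min lexx.
have kd : kappa <= a ^+ 2 * d / 32 by rewrite ge_min lexx orbT.
have a20 : 0 < a ^+ 2 by rewrite exprn_gt0.
have k0 : 0 < kappa by rewrite lt_min ltr01 divr_gt0 // mulr_gt0.
have [||F [D [hF Dgap mD mF]]] := near_extremal a r M kappa N r0 _ _ a0 aM k0; [lra|rewrite /M; lra|].
have Fpos := admissible_gt0 _ _ _ _ _ r0 hF.
have [F0 FN Fa FrM] := hF.
have p1 t : modulus ((1 - F).[circle_param t] - 1 : CC R) = modulus (F.[circle_param t] : CC R).
  by rewrite !hornerE addrAC subrr sub0r modulusN.
exists (1 - F); split.
- move=> [_|k kN]; rewrite coefB coef1 /= ?F0 ?subrr // FN ?subrr //.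
- move=> [|k]; rewrite coefB coef1 /= ?F0 ?subrr ?modulus0 ?(ltW a'0) //.
  by rewrite sub0r modulusN (le_trans (Fa _ _)).
- move=> z z1; rewrite !hornerE (le_trans (modulusB _ _)) // modulus1 lerD2l.
  by have /andP[_ /ltW] := FrM _ z1.
have c1 := ln_circle_continuous _ Fpos.
have c2 := sqr_circle_continuous D.
have c3 : continuous (fun t : R => ln (modulus (F.[circle_param t] : CC R)) + (- ln r)).
  by apply: fun_continuousD => // t; exact: cvg_cst.
(* The function to which Markov's inequality applies is
   (ln |F| - ln r) / Y + (16 / a^2) |D|^2. *)
have c4 := fun_continuousZ (Y^-1) _ c3.
have c5 := fun_continuousZ (16 / a ^+ 2) _ c2.
have c6 := fun_continuousD _ _ c4 c5.
have lnFr t : 0 <= ln (modulus (F.[circle_param t] : CC R)) - ln r.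
  have /andP[h1 _] := FrM _ (circle_param_unit t).
  by rewrite subr_ge0 ler_ln ?posrE ?(ltW h1) // (lt_trans r0).
have D2 t : 0 <= 16 / a ^+ 2 * modulus (D.[circle_param t] : CC R) ^+ 2.
  by rewrite mulr_ge0 ?sqr_ge0 // divr_ge0 // ltW.
have Yv : 0 < Y^-1 by rewrite invr_gt0.
apply: (le_trans (measure_le_mean _ _ (far_from_1_measurable _ _) _ c6 _ _)).
- by move=> t [].
- by move=> t; rewrite addr_ge0 // mulr_ge0 // ltW.
- move=> t [_ /=]; rewrite p1 => eF.
  have [h|h] := leP (r * expR Y) (modulus (F.[circle_param t] : CC R)).
    apply: ler_wpDr => //; rewrite ler_pdivlMl // mulr1 lerBrDl.
    rewrite -[X in _ + X]expRK -lnM ?posrE ?expR_gt0 // ler_ln ?posrE //.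
      by rewrite mulr_gt0 // expR_gt0.
    by rewrite (lt_le_trans _ h) // mulr_gt0 // expR_gt0.
  apply: ler_wpDl; first by rewrite mulr_ge0 // ltW.
  have := Dgap _ (circle_param_unit t).
  rewrite /gap [Num.min a _]min_l; last by rewrite le_min /M; apply/andP; split; lra.
  move=> Da; have : (a / 4) ^+ 2 <= modulus (D.[circle_param t] : CC R) ^+ 2.
    by rewrite lerXn2r ?nnegrE ?modulus_ge0 // divr_ge0 // ltW.
  have -> : 16 / a ^+ 2 = ((a / 4) ^+ 2)^-1 by field; rewrite gt_eqF.
  by rewrite ler_pdivlMl ?mulr1 // exprn_gt0 // divr_gt0.
rewrite lee_fin (meanD _ _ c4 c5) (meanZ _ _ c3) (meanZ _ _ c2).
have ccst : continuous (fun _ : R => - ln r) by move=> t; exact: cvg_cst.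
rewrite (meanD _ _ c1 ccst) mean_cst.
apply: le_trans dd; rewrite [leRHS]splitr; apply: lerD.
  rewrite ler_pdivrMl // /Y; have -> : 2 * (2 - ln r) / d * (d / 2) = 2 - ln r.
    by field; rewrite gt_eqF.
  lra.
rewrite mulrAC ler_pdivrMr //; lra.
Qed.

(** * Uniqueness of power series *)

Definition has_power_series {R : realType} (f : CC R -> CC R) (a : nat -> CC R) :=
  forall z, @unit_disc R z -> [series a k * z ^+ k]_k @ \oo --> f z.

(** Proved with the stronger bound 2 q^p - 2 q^n, which passes through the
    induction. *)
Lemma geometric_tail_le {R : realType} (q : R) p n : 0 <= q -> q <= 1 / 2 ->
  \sum_(p <= k < n) q ^+ k <= 2 * q ^+ p.
Proof.
move=> q0 q1; have [np|pn] := leqP n p.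
  by rewrite big_geq // mulr_ge0 // exprn_ge0.
apply: (@le_trans _ _ (2 * q ^+ p - 2 * q ^+ n)); last first.
  by rewrite gerBl mulr_ge0 // exprn_ge0.
elim: n pn => // n ih; rewrite ltnS leq_eqVlt => /orP[/eqP <-|pn].
  by rewrite big_nat1 exprS; have := exprn_ge0 p q0; nra.
rewrite big_nat_recr ?(ltnW pn) //=; have := ih pn; rewrite [q ^+ n.+1]exprS.
by have := exprn_ge0 n q0; nra.
Qed.

(** If a m is the first nonzero coefficient, then convergence at 1/2 gives
    |a k| <= B 2^k, and at a small x > 0 the term a m x^m outweighs the sum of
    all the following ones. *)
Lemma power_series0 {R : realType} (a : nat -> CC R) :
  has_power_series (fun=> 0) a -> forall k, a k = 0.
Proof.
move=> ha.
have cvg0 (x : R) : 0 <= x -> x < 1 -> forall e, 0 < e -> exists n0, forall n, (n0 <= n)%N ->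
    modulus (\sum_(0 <= k < n) a k * (x%:C%C) ^+ k : CC R) < e.
  move=> x0 x1 e e0; have xd : @unit_disc R (x%:C%C : CC R).
    by rewrite /unit_disc /= modulus_real ger0_norm.
  have [n0 _ h] := iffLR (cvg_modulus _ _) (ha _ xd) _ e0.
  by exists n0 => n nn; have := h n nn; rewrite /= sub0r modulusN /series.
have half0 : 0 <= 1 / 2 :> R by lra.
have half1 : 1 / 2 < 1 :> R by lra.
have [n0 hn0] := cvg0 _ half0 half1 1 ltr01.
set h : R[i] := ((1 / 2 : R)%:C)%C in hn0.
(* From n0 on, two consecutive partial sums at 1/2 are both less than 1; the
   finitely many other terms are added by hand. *)
pose B : R := 2 + \sum_(0 <= k < n0) modulus (a k * h ^+ k : CC R).
have sumB0 : 0 <= \sum_(0 <= k < n0) modulus (a k * h ^+ k : CC R).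
  by apply: sumr_ge0 => k _; exact: modulus_ge0.
have B0 : 0 < B by rewrite /B; lra.
have hB k : modulus (a k * h ^+ k : CC R) <= B.
  have [kn|kn] := ltnP k n0.
    rewrite /B (bigD1_seq k) ?mem_index_iota ?iota_uniq //= addrCA lerDl.
    by rewrite addr_ge0 // sumr_ge0 // => i _; exact: modulus_ge0.
  have := hn0 _ (leqW kn); have := hn0 _ kn; rewrite big_nat_recr //=.
  set s := \sum_(0 <= i < k) _; set t := a k * _ => h1 h2.
  have := modulusB_ge t (- s); rewrite modulusN opprK [t + s]addrC /B; lra.
have hmod : modulus (h : CC R) = 1 / 2 by rewrite modulus_real ger0_norm.
have aB k : modulus (a k) <= B * 2 ^+ k.
  have := hB k; rewrite modulusM modulusX hmod mul1r exprVn => h1.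
  by rewrite -ler_pdivrMr ?exprn_gt0.
move=> m; elim/ltn_ind: m => m ih; apply: contrapT => am.
have c0 : 0 < modulus (a m).
  by rewrite lt_neqAle modulus_ge0 andbT eq_sym; apply/eqP => /modulus0_eq0.
set c := modulus (a m) in c0.
pose x := Num.min (1 / 4) (c / (B * 2 ^+ m.+3)).
have B2 : 0 < B * 2 ^+ m.+3 by rewrite mulr_gt0 // exprn_gt0.
have x0 : 0 < x by rewrite lt_min divr_gt0 //= divr_gt0.
have x4 : x <= 1 / 4 by rewrite ge_min lexx.
have xc : x * (B * 2 ^+ m.+3) <= c.
  by rewrite -ler_pdivlMr // ge_min lexx orbT.
have xm0 : 0 < x ^+ m by rewrite exprn_gt0.
have e0 : 0 < c * x ^+ m / 2 by rewrite divr_gt0 // mulr_gt0.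
have x1 : x < 1 by lra.
have [n1 hn1] := cvg0 x (ltW x0) x1 _ e0.
have := hn1 (n1 + m.+1)%N (leq_addr _ _).
rewrite (@big_cat_nat _ _ _ m) //=; last by rewrite ltnW // leq_addl.
rewrite big_nat_cond big1 ?add0r; last first.
  by move=> k; rewrite andbT => /andP[_ km]; rewrite ih // mul0r.
rewrite big_ltn; last exact: leq_addl.
set T := \sum_(_ <= _ < _) _.
have hT : modulus (T : CC R) <= B * (2 * (2 * x) ^+ m.+1).
  rewrite (le_trans (modulus_sum _ _ _ _)) //.
  apply: (@le_trans _ _ (\sum_(m.+1 <= k < n1 + m.+1) B * (2 * x) ^+ k)).
    apply: ler_sum => k _; rewrite modulusM modulusX modulus_real ger0_norm ?(ltW x0) //.
    by rewrite exprMn mulrA ler_wpM2r ?exprn_ge0 ?(ltW x0).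
  by rewrite -mulr_sumr ler_wpM2l ?(ltW B0) // geometric_tail_le //; lra.
have eT : B * (2 * (2 * x) ^+ m.+1) = x * (B * 2 ^+ m.+3) * x ^+ m / 2.
  by rewrite exprMn !exprS; field.
rewrite {}eT in hT.
have : modulus (a m * (x%:C%C : R[i]) ^+ m : CC R) = c * x ^+ m.
  by rewrite modulusM modulusX modulus_real ger0_norm // ltW.
have := modulusB_ge (a m * (x%:C%C : R[i]) ^+ m) (- T); rewrite modulusN opprK.
have : x * (B * 2 ^+ m.+3) * x ^+ m <= c * x ^+ m by rewrite ler_wpM2r // ltW.
lra.
Qed.

Lemma power_seriesB {R : realType} (f g : CC R -> CC R) a b :
  has_power_series f a -> has_power_series g b ->
  has_power_series (fun z => f z - g z) (fun k => a k - b k).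
Proof.
move=> fa gb z zd.
have -> : [series (a k - b k) * z ^+ k]_k =
    ([series a k * z ^+ k]_k : nat -> CC R) - ([series b k * z ^+ k]_k : nat -> CC R).
  apply/funext => n; rewrite !fctE /series /= -sumrB.
  by apply: eq_bigr => k _; rewrite mulrBl.
by apply: (@cvgB _ (CC R)); [exact: fa|exact: gb].
Qed.

Lemma power_series_unique {R : realType} (f : CC R -> CC R) a b :
  has_power_series f a -> has_power_series f b -> a = b.
Proof.
move=> fa fb; apply/funext => k; apply/eqP; rewrite -subr_eq0; apply/eqP.
apply: (power_series0 (fun k => a k - b k)) => z zd.
by have := power_seriesB _ _ _ _ fa fb z zd; rewrite subrr.
Qed.

Lemma taylorE {R : realType} (f : CC R -> CC R) a :
  has_power_series f a -> taylor f = a.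
Proof.
move=> fa; apply: (@power_series_unique _ f) => //.
by apply: (@xgetPex _ _ [set a : nat -> CC R | has_power_series f a]); exists a.
Qed.

Lemma taylor0 {R : realType} (f : CC R -> CC R) :
  ~ (exists a, has_power_series f a) -> taylor f = (fun=> 0).
Proof. by move=> h; rewrite /taylor xgetPN // => a ha; apply: h; exists a. Qed.

Lemma horner_power_series {R : realType} (p : {poly R[i]}) :
  has_power_series (fun z => p.[z]) (fun k => p`_k).
Proof.
move=> z _; apply: (@cvg_near_cst _ (CC R)).
near=> n; rewrite /series /= big_mkord -horner_coef_wide //.
by near: n; exact: nbhs_infty_ge.
Unshelve. all: by end_near. Qed.

(** f and p - f have power series on the disc at the same time.  When they have
    none, [taylor] takes its default value 0 on both, and the Psi-norm of p - f
    vanishes: either alternative gives the estimates wanted. *)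
Lemma taylor_poly_sub {R : realType} (p : {poly R[i]}) (f : CC R -> CC R) :
  (forall k, taylor (fun z => p.[z] - f z) k = p`_k - taylor f k) \/
  (forall k, taylor (fun z => p.[z] - f z) k = 0).
Proof.
have [[a fa]|nf] := pselect (exists a, has_power_series f a).
  left=> k; rewrite (taylorE _ _ fa).
  by rewrite (taylorE _ _ (power_seriesB _ _ _ _ (horner_power_series p) fa)).
right=> k; suff -> : taylor (fun z => p.[z] - f z) = (fun=> 0) by [].
apply: taylor0 => -[a ha]; apply: nf; exists (fun k => p`_k - a k) => z zd.
have := power_seriesB _ _ _ _ (horner_power_series p) ha z zd.
have -> : p.[z] - (p.[z] - f z) = f z by rewrite opprB addrC subrK.
by [].
Qed.

(** * Young functions and negligible polynomials *)

Lemma young_ge0 {R : realType} (Psi : R -> R) x : young Psi -> 0 <= x -> 0 <= Psi x.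
Proof.
by move=> [_ P0 Pp _]; rewrite le_eqVlt => /predU1P[<-|/Pp/ltW//]; rewrite P0.
Qed.

(** A convex function that vanishes at 0 satisfies Psi (t y) <= t Psi y for t in
    [0, 1]. *)
Lemma young_mono {R : realType} (Psi : R -> R) x y :
  young Psi -> 0 <= x -> x <= y -> Psi x <= Psi y.
Proof.
move=> yP x0 xy; have [cP P0 Pp _] := yP.
have y0 : 0 <= y by exact: le_trans xy.
have [y00|yn0] := eqVneq y 0.
  suff -> : x = y by [].
  by apply/eqP; rewrite eq_le xy y00 x0.
have yp : 0 < y by rewrite lt_neqAle eq_sym yn0.
have t0 : 0 <= x / y by rewrite divr_ge0.
have t1 : x / y <= 1 by rewrite ler_pdivrMr // mul1r.
have h : Psi (x / y * y + (1 - x / y) * 0) <= x / y * Psi y + (1 - x / y) * Psi 0.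
  by apply: (cP (Itv01 t0 t1) y 0); rewrite inE /= in_itv /= ?y0 ?lexx.
rewrite P0 !mulr0 !addr0 divfK // in h.
by apply: le_trans h _; rewrite ler_piMl // young_ge0.
Qed.

(** The doubling condition bounds Psi (l x) by a multiple of Psi x for small x, and
    summability forces the terms to be small. *)
Lemma young_tail {R : realType} (Psi : R -> R) (a : nat -> R) (l : R) :
  young Psi -> (forall n, 0 <= a n) -> 0 <= l ->
  (\sum_(0 <= n <oo) (Psi (a n))%:E < +oo)%E ->
  exists N, forall n, \sum_(N <= k < n) Psi (l * a k) <= 1 / 2.
Proof.
move=> yP a0 l0 fin; have [_ P0 Pp [c1 [c [_ c0 nc]]]] := yP.
have [d d0 hd] : exists2 d, 0 < d & forall x, 0 < x -> x < d -> Psi (2 * x) <= c * Psi x.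
  move: nc; rewrite near_withinE => /nbhs_normP[d /= d0 h]; exists d => // x x0 xd.
  by have /(_ x) := h; rewrite /= sub0r normrN gtr0_norm // => /(_ xd x0) /andP[].
pose q := Num.bound l.
have lq : l <= 2 ^+ q.
  rewrite (le_trans (ltW (archi_boundP l0))) // -natrX ler_nat ltnW //; exact: ltn_expl.
have p2 j : 0 < 2 ^+ j :> R by rewrite exprn_gt0.
have scale j x : 0 <= x -> 2 ^+ j * x < d -> Psi (2 ^+ j * x) <= c ^+ j * Psi x.
  rewrite le_eqVlt => /predU1P[<- _|x0]; first by rewrite mulr0 P0 mulr0.
  elim: j => [|j ih]; first by rewrite !expr0 !mul1r.
  rewrite !exprS -!mulrA => hj.
  have jx : 0 < 2 ^+ j * x by rewrite mulr_gt0.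
  have jd : 2 ^+ j * x < d by lra.
  by rewrite (le_trans (hd _ jx jd)) // ler_wpM2l ?(ltW c0) // ih.
have dq : 0 < d / 2 / 2 ^+ q by rewrite !divr_gt0.
have u0 n : (0 <= (Psi (a n))%:E)%E by rewrite lee_fin young_ge0.
pose t := Num.min (Psi (d / 2 / 2 ^+ q)) (1 / 2 / c ^+ q).
have t0 : 0 < t by rewrite lt_min Pp // !divr_gt0 // exprn_gt0.
have [N hN] : exists N, (\sum_(N <= k <oo) (Psi (a k))%:E < t%:E)%E.
  have := @nneseries_tail_cvg R (fun n => (Psi (a n))%:E) xpredT fin (fun k _ => u0 k).
  move=> /fine_cvgP[fn /cvgrPdist_lt/(_ _ t0)] cv.
  have [N [h1 h2]] := filter_ex (filterI fn cv); exists N.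
  rewrite -(fineK h1) lte_fin; move: h2; rewrite /= sub0r normrN; apply: le_lt_trans.
  exact: ler_norm.
exists N => n.
have part m : (N <= m)%N -> \sum_(N <= k < m) Psi (a k) < t.
  move=> _; rewrite -lte_fin -sumEFin; apply: le_lt_trans hN.
  by apply: nneseries_lim_ge => k _ _; exact: u0.
have small k : (N <= k)%N -> a k < d / 2 / 2 ^+ q.
  move=> Nk; rewrite ltNge; apply/negP => h.
  have := part k.+1 (leqW Nk); rewrite big_nat_recr //= ltNge => /negP; apply.
  apply: (@le_trans _ _ (Psi (a k))); last first.
    by rewrite lerDr sumr_ge0 // => i _; rewrite -lee_fin; exact: u0.
  by rewrite (@le_trans _ _ (Psi (d / 2 / 2 ^+ q))) ?ge_min ?lexx // young_mono // ltW.
have [nN|Nn] := leqP n N; first by rewrite big_geq // divr_ge0.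
apply: (@le_trans _ _ (\sum_(N <= k < n) c ^+ q * Psi (a k))).
  rewrite big_nat_cond [leRHS]big_nat_cond; apply: ler_sum => k /andP[/andP[Nk _] _].
  apply: (@le_trans _ _ (Psi (2 ^+ q * a k))).
    by apply: young_mono => //; rewrite ?mulr_ge0 // ler_wpM2r.
  apply: scale => //; have := small _ Nk; rewrite ltr_pdivlMr // mulrC => h.
  by apply: lt_trans h _; lra.
rewrite -mulr_sumr mulrC -ler_pdivlMr ?exprn_gt0 //.
by rewrite (le_trans (ltW (part _ (ltnW Nn)))) // ge_min lexx orbT.
Qed.

Lemma sum_norm_coef_le {R : realType} (p P : {poly R[i]}) (a A : R) k :
  (forall j, modulus (p`_j : CC R) <= a) ->
  \sum_(j < size P) modulus (P`_j : CC R) <= A ->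
  modulus ((P * p)`_k : CC R) <= A * a.
Proof.
move=> pa PA; have a0 : 0 <= a := le_trans (modulus_ge0 _) (pa 0%N).
rewrite coefM; apply: le_trans (modulus_sum _ _ _ _) _.
apply: (@le_trans _ _ (\sum_(j < k.+1) modulus (P`_j : CC R) * a)).
  by apply: ler_sum => j _; rewrite modulusM ler_wpM2l ?modulus_ge0.
rewrite -mulr_suml ler_wpM2r //; apply: le_trans PA.
rewrite -!(big_mkord xpredT (fun j => modulus (P`_j : CC R))).
have [h|h] := leqP k.+1 (size P).
  rewrite [leRHS](@big_cat_nat _ _ _ k.+1) //= lerDl.
  by apply: sumr_ge0 => i _; exact: modulus_ge0.
rewrite (@big_cat_nat _ _ _ (size P)) //=; last exact: ltnW.
rewrite [X in _ + X]big_nat_cond [X in _ + X]big1 ?addr0 // => j /andP[/andP[sj _] _].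
by rewrite nth_default // modulus0.
Qed.

Lemma sum_norm_horner_le {R : realType} (P : {poly R[i]}) (A : R) (z : CC R) :
  modulus z = 1 -> \sum_(j < size P) modulus (P`_j : CC R) <= A ->
  modulus (P.[z] : CC R) <= A.
Proof.
move=> z1 PA; rewrite horner_coef; apply: le_trans (modulus_sum _ _ _ _) _.
by under eq_bigr do rewrite modulusM modulusX z1 expr1n mulr1.
Qed.

(** A negligible polynomial close to 1 serves to replace a Laurent polynomial
    P / z^m by a polynomial d; N bounds the order of the pole and A the size of P,
    and A is also the inverse of the scale at which d has small Psi-norm. *)
Definition absorbs {R : realType} (Psi : R -> R) N (A : R) (p : {poly R[i]}) : Prop :=
  forall (P : {poly R[i]}) m, (m <= N)%N ->
    \sum_(j < size P) modulus (P`_j : CC R) <= A ->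
  exists d : {poly R[i]},
    (forall z : CC R, modulus z = 1 -> d.[z] = P.[z] / z ^+ m * p.[z]) /\
    forall n, \sum_(k < n) Psi (A * modulus (d`_k : CC R)) <= 1 / 2.

(** A flat polynomial p divisible by X^N absorbs: the coefficients of P p are at
    most A a, and their squares sum to at most (A M)^2 by Parseval.  Once A^2 a is
    in the range where Psi t <= kappa t^2, the Psi-sum is at most
    kappa A^4 M^2. *)
Lemma exists_absorbing {R : realType} (Psi : R -> R) (e delta A : R) N :
  young Psi -> ratio_decreases_to0 Psi -> 0 < e -> 0 < delta -> 0 < A ->
  exists p : {poly R[i]},
    (lebesgue_measure (far_from_1 e p) <= delta%:E)%E /\ absorbs Psi N A p.
Proof.
move=> yP [_ rP] e0 d0 A0.
have [M M0 hM] := exists_flat_near_1 _ _ e0 d0.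
(* M is known before kappa, hence before tau and a. *)
pose kappa := (2 * A ^+ 4 * M ^+ 2)^-1.
have k0 : 0 < kappa by rewrite invr_gt0 !mulr_gt0 ?exprn_gt0.
have [tau tau0 htau] : exists2 tau, 0 < tau & forall t, 0 < t -> t < tau -> Psi t <= kappa * t ^+ 2.
  have /cvgrPdist_lt /(_ _ k0) := rP.
  rewrite near_withinE => /nbhs_normP[tau /= tau0 h]; exists tau => // t t0 tt.
  have := h t; rewrite /= !sub0r !normrN gtr0_norm // => /(_ tt t0).
  rewrite ger0_norm; last by rewrite divr_ge0 ?sqr_ge0 // young_ge0 // ltW.
  by rewrite ltr_pdivrMr ?exprn_gt0 // => /ltW.
pose a := tau / (2 * A ^+ 2).
have a0 : 0 < a by rewrite divr_gt0 // mulr_gt0 // exprn_gt0.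
have [p [pN pa pM pd]] := hM a N a0.
exists p; split=> // P m mN PA.
exists (P * drop_poly m p).
have dM (z : CC R) : modulus z = 1 -> (P * drop_poly m p).[z] = P.[z] / z ^+ m * p.[z].
  move=> z1; have z0 : z != 0.
    by apply: contra_eq_neq z1 => ->; rewrite modulus0 eq_sym oner_eq0.
  have -> : p.[z] = (drop_poly m p).[z] * z ^+ m.
    rewrite -{1}(poly_take_drop m p) (_ : take_poly m p = 0) ?add0r.
      by rewrite hornerM hornerXn.
    by apply/polyP => k; rewrite coef_take_poly coef0; case: ifP => // km; rewrite pN // (leq_trans km).
  by rewrite hornerM; field; rewrite expf_neq0.
split=> // n; set d := P * _ in dM *.
have da k : modulus (d`_k : CC R) <= A * a.
  by apply: sum_norm_coef_le => // j; rewrite coef_drop_poly.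
have dT : \sum_(k < n) modulus (d`_k : CC R) ^+ 2 <= (A * M) ^+ 2.
  apply: sum_coef_le_sup => z z1; rewrite dM // !modulusM modulusV modulusX z1 expr1n invr1 mulr1.
  by apply: ler_pM; rewrite ?modulus_ge0 ?pM // sum_norm_horner_le.
apply: (@le_trans _ _ (\sum_(k < n) kappa * A ^+ 2 * modulus (d`_k : CC R) ^+ 2)).
  apply: ler_sum => k _; have := modulus_ge0 d`_k.
  rewrite le_eqVlt => /predU1P[<-|dp].
    by rewrite mulr0; have [_ -> _ _] := yP; rewrite expr0n /= mulr0.
  rewrite -mulrA -exprMn; apply: htau; first exact: mulr_gt0.
  apply: (@le_lt_trans _ _ (A * (A * a))); first by rewrite ler_pM2l.
  have -> : A * (A * a) = tau / 2 by rewrite /a; field; rewrite gt_eqF.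
  by rewrite ltr_pdivrMr // mulr2n mulrDr mulr1 ltrDl.
rewrite -mulr_sumr; apply: (@le_trans _ _ (kappa * A ^+ 2 * (A * M) ^+ 2)).
  by rewrite ler_wpM2l // mulr_ge0 ?sqr_ge0 // ltW.
by rewrite le_eqVlt; apply/orP; left; apply/eqP; rewrite /kappa; field; rewrite !gt_eqF.
Qed.

(** * Simultaneous approximation *)

(** Remove from the circle the sets where p_j is at distance more than (j+1)^-2
    from 1; the j-th has measure at most eps / 2^(j+2).  The tolerance (j+1)^-2
    still tends to 0 after multiplication by a Laurent polynomial of size j+1. *)
Lemma exists_compact {R : realType} (Psi : R -> R) (eps : R) :
  young Psi -> ratio_decreases_to0 Psi -> 0 < eps -> eps <= 1 ->
  exists K : set (CC R), [/\ K `<=` @unit_circle R, compact K,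
    ((1 - eps)%:E < circle_measure K)%E, K !=set0 &
    forall j, exists p, absorbs Psi j j.+1%:R p /\
      forall z, K z -> modulus (p.[z] - 1 : CC R) <= j.+1%:R ^- 2].
Proof.
move=> yP rP eps0 eps1.
have ex (j : nat) : exists p, (lebesgue_measure (far_from_1 (j.+1%:R ^- 2) p) <=
    (eps / 2 / (2 ^ j.+1)%:R)%:E)%E /\ absorbs Psi j j.+1%:R p.
  by apply: exists_absorbing => //; rewrite ?divr_gt0 ?invr_gt0 ?exprn_gt0 ?ltr0n ?expn_gt0.
have [p hp] := choice ex.
pose U j := [set t : R | j.+1%:R ^- 2 < modulus ((p j).[circle_param t] - 1 : CC R)].
pose K0 : set R := `[0, 1] `&` ~` \bigcup_j U j.
have cK0 : compact K0.
  apply: (subclosed_compact _ (@segment_compact R 0 1)); last by move=> t [].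
  apply: closedI; first exact: (compact_closed _ (@segment_compact R 0 1)).
  apply: open_closedC; apply: bigcup_open => j _; exact: far_from_1_open.
pose K := @circle_param R @` K0.
have KT : K `<=` @unit_circle R by move=> _ [t _ <-]; exact: circle_param_unit.
have cK : compact (K : set (CC R)) by exact: circle_image_compact.
pose B := `[0, 1[ `&` @circle_param R @^-1` K.
have mB : measurable B.
  apply: measurableI => //; apply: measurable_realfun.closed_measurable.
  apply: closed_comp; first by move=> t _; exact: circle_param_continuous.
  exact: (compact_closed _ cK).
have mU j : measurable (far_from_1 (j.+1%:R ^- 2) (p j)) by exact: far_from_1_measurable.
have mV : measurable (\bigcup_j far_from_1 (j.+1%:R ^- 2) (p j)) by exact: bigcup_measurable.
have cover : `[0, 1[ `<=` B `|` \bigcup_j far_from_1 (j.+1%:R ^- 2) (p j).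
  move=> t t01; have t01' : t \in `[0, 1]%R.
    by move: t01; rewrite /= !in_itv /= => /andP[-> /ltW].
  have [[j _ Uj]|h] := pselect ((\bigcup_j U j) t); first by right; exists j.
  by left; split=> //; exists t.
have far : (lebesgue_measure (\bigcup_j far_from_1 (j.+1%:R ^- 2) (p j)) <= (eps / 2)%:E)%E.
  apply: (le_trans (measure_sigma_subadditive _ _ _ (@subset_refl _ _))) => //.
  have e2 : 0 <= eps / 2 by rewrite divr_ge0 // ltW.
  apply: le_trans (epsilon_trick0 xpredT e2).
  by apply: lee_nneseries => // j _; have [] := hp j.
have big : ((1 - eps)%:E < circle_measure K)%E.
  have h : (1%:E <= circle_measure K + (eps / 2)%:E)%E.
    apply: (@le_trans _ _ (lebesgue_measure (`[0, 1[ : set R))).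
      by rewrite lebesgue_measure_itv /= lte01 -EFinB subr0.
    apply: (@le_trans _ _ (lebesgue_measure (B `|` \bigcup_j far_from_1 (j.+1%:R ^- 2) (p j)))).
      by apply: le_measure => //; rewrite inE //; exact: measurableU.
    apply: (le_trans (measureU2 lebesgue_measure mB mV)).
    by rewrite leeD2l.
  rewrite -(@lteD2rE _ (eps / 2)%:E) //; apply: lt_le_trans h.
  by rewrite -EFinD lte_fin; lra.
have K_n0 : K !=set0.
  apply/set0P/eqP => K_0; move: big; rewrite /circle_measure K_0 preimage_set0 setI0 measure0.
  by rewrite lte_fin; lra.
exists K; split=> // j; exists (p j); have [_ ?] := hp j; split=> // _ [t [t01 tU] <-].
by rewrite leNgt; apply/negP => h; apply: tU; exists j.
Qed.

Lemma norm_Psi_le {R : realType} (Psi : R -> R) (f : CC R -> CC R) (eta : R) :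
  0 < eta -> young Psi ->
  (forall n, \sum_(k < n) Psi (modulus (taylor f k) / eta) <= 1) ->
  (norm_Psi Psi f <= eta%:E)%E.
Proof.
move=> eta0 yP h; apply: ereal_inf_lbound; exists eta => //; split=> //.
apply: lime_le.
  apply: is_cvg_nneseries => k _ _; rewrite lee_fin young_ge0 // divr_ge0 ?modulus_ge0 //.
  exact: ltW.
by apply: nearW => n; rewrite big_mkord sumEFin lee_fin.
Qed.

Lemma norm_Psi_ge0 {R : realType} (Psi : R -> R) (f : CC R -> CC R) :
  (0 <= norm_Psi Psi f)%E.
Proof. by apply: le_ereal_inf_tmp => _ [M [M0 _] <-]; rewrite lee_fin ltW. Qed.

(** Q = S + d, with S a Taylor polynomial of f, P / z^m a Laurent approximation of
    g - S on K, and d the polynomial that p_j provides in place of P / z^m.  The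
    coefficients of Q - f are those of d, minus the tail of those of f. *)
Lemma approximation {R : realType} (Psi : R -> R) (K : set (CC R)) (f g : CC R -> CC R) (eta : R) :
  young Psi -> K `<=` @unit_circle R -> compact K ->
  (forall j, exists p, absorbs Psi j j.+1%:R p /\
      forall z, K z -> modulus (p.[z] - 1 : CC R) <= j.+1%:R ^- 2) ->
  (psi_sum Psi f 1 < +oo)%E -> {within K, continuous g} -> 0 < eta ->
  exists Q : {poly R[i]}, (norm_Psi Psi (fun z => (Q.[z] - f z)%R) <= eta%:E)%E /\
    forall z, K z -> modulus (Q.[z] - g z : CC R) <= eta.
Proof.
move=> yP KT cK hp ff cg eta0.
have l0 : 0 <= 2 / eta by rewrite divr_ge0 // ltW.
have [N hN] : exists N, forall n, \sum_(N <= k < n) Psi (2 / eta * modulus (taylor f k)) <= 1 / 2.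
  apply: (@young_tail R Psi (fun k => modulus (taylor f k))) => // [n|]; first exact: modulus_ge0.
  by move: ff; rewrite /psi_sum; under eq_eseriesr do rewrite divr1.
pose S : {poly R[i]} := \poly_(k < N) taylor f k.
have eta2 : 0 < eta / 2 by rewrite divr_gt0.
have cgS : {within K, continuous (fun z => g z - S.[z] : CC R)}.
  move=> z; apply: (@cvgB _ (CC R)); first exact: cg.
  exact: (continuous_subspaceT (horner_continuous S)).
have [m [P hP]] := laurent_dense _ _ _ KT cK cgS eta2.
pose A := \sum_(i < size P) modulus (P`_i : CC R).
have A0 : 0 <= A by apply: sumr_ge0 => i _; exact: modulus_ge0.
(* Large enough for the pole m, for the size A of P and for the scale 2 / eta. *)
pose j := (m + Num.bound A + Num.bound (2 / eta))%N.
have jA : A <= j.+1%:R.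
  by rewrite (le_trans (ltW (archi_boundP A0))) // ler_nat /j; lia.
have jl : 2 / eta <= j.+1%:R.
  by rewrite (le_trans (ltW (archi_boundP l0))) // ler_nat /j; lia.
have j0 : 0 < j.+1%:R :> R by rewrite ltr0n.
have [p [cp p1]] := hp j.
have mj : (m <= j)%N by rewrite /j; lia.
have [d [dz dP]] := cp P m mj jA.
exists (S + d); split; last first.
  move=> z Kz; have z1 := KT _ Kz; rewrite hornerD dz //.
  have -> : S.[z] + P.[z] / z ^+ m * p.[z] - g z =
      P.[z] / z ^+ m * (p.[z] - 1) + (P.[z] / z ^+ m - (g z - S.[z])) :> R[i] by ring.
  rewrite (le_trans (modulusD _ _)) // [leRHS]splitr; apply: lerD; last exact: ltW (hP _ Kz).
  rewrite !modulusM modulusV modulusX z1 expr1n invr1 mulr1.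
  apply: (@le_trans _ _ (j.+1%:R * j.+1%:R ^- 2)).
    by apply: ler_pM; rewrite ?modulus_ge0 ?p1 //; exact: sum_norm_horner_le.
  rewrite expr2 invfM mulrA divff ?gt_eqF // mul1r -[eta / 2]invrK lef_pV2 ?posrE ?invr_gt0 //.
  by rewrite invf_div.
apply: norm_Psi_le => // n.
have [|] := taylor_poly_sub (S + d) f; last first.
  move=> h; have [_ P0 _ _] := yP.
  by rewrite big1 // => k _; rewrite h modulus0 mul0r P0.
move=> h; pose b k := if (N <= k)%N then Psi (2 / eta * modulus (taylor f k)) else 0.
have l0' : 0 < 2 / eta by rewrite divr_gt0.
have le1 k : Psi (modulus (taylor (fun z => (S + d).[z] - f z)%R k) / eta) <=
    Psi (j.+1%:R * modulus (d`_k : CC R)) + b k.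
  have md := modulus_ge0 (d`_k).
  have Pd : Psi (2 / eta * modulus (d`_k : CC R)) <= Psi (j.+1%:R * modulus (d`_k : CC R)).
    by apply: young_mono; [|exact: mulr_ge0|exact: ler_wpM2r].
  have Pd0 : 0 <= Psi (j.+1%:R * modulus (d`_k : CC R)).
    by rewrite young_ge0 // mulr_ge0 // ltW.
  rewrite h coefD coef_poly /b; case: ltnP => kN.
    rewrite addrAC subrr add0r addr0; apply: le_trans Pd; apply: young_mono => //.
      by rewrite divr_ge0 // ltW.
    by rewrite mulrC ler_wpM2r // ler_peMl ?invr_ge0 ?(ltW eta0) // ler1n.
  rewrite add0r; set x := modulus (taylor f k).
  have x0 : 0 <= x by exact: modulus_ge0.
  have Px0 : 0 <= Psi (2 / eta * x) by rewrite young_ge0 // mulr_ge0.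
  have dx := modulusB d`_k (taylor f k); rewrite -/x in dx.
  (* Half of the sum is at most the maximum, and Psi of the maximum is at most the
     sum of the values of Psi. *)
  have [xd|xd] := leP x (modulus (d`_k : CC R)).
    apply: ler_wpDr => //; apply: le_trans Pd; apply: young_mono => //.
      by rewrite divr_ge0 ?modulus_ge0 // ltW.
    by rewrite [leRHS]mulrAC ler_wpM2r ?invr_ge0 ?(ltW eta0) //; lra.
  apply: ler_wpDl => //; apply: young_mono => //.
    by rewrite divr_ge0 ?modulus_ge0 // ltW.
  by rewrite [leRHS]mulrAC ler_wpM2r ?invr_ge0 ?(ltW eta0) //; lra.
apply: (@le_trans _ _ (\sum_(k < n) (Psi (j.+1%:R * modulus (d`_k : CC R)) + b k))).
  by apply: ler_sum => k _; exact: le1.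
rewrite big_split /= [leRHS](splitr 1); apply: lerD; first exact: dP.
apply: le_trans (hN n).
rewrite -(big_mkord xpredT b); have [nN|Nn] := leqP n N.
  rewrite big_nat_cond big1 ?big_geq // => k /andP[/andP[_ kn] _].
  by rewrite /b leqNgt (leq_trans kn nN).
rewrite (@big_cat_nat _ _ _ N) //=; last exact: ltnW.
rewrite big_nat_cond big1 ?add0r; last first.
  by move=> k /andP[/andP[_ kn] _]; rewrite /b leqNgt kn.
rewrite big_nat_cond [leRHS]big_nat_cond; apply: ler_sum => k /andP[/andP[Nk _] _].
by rewrite /b Nk.
Qed.

Theorem theorem2p5 (R : realType) (Psi : R -> R) :
  young Psi -> ratio_decreases_to0 Psi ->
  forall eps : R, 0 < eps ->
  exists K : set (CC R),
    [/\ K `<=` @unit_circle R,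
        compact K,
        ((1 - eps)%:E < circle_measure K)%E &
        forall f g : CC R -> CC R,
          ellPsi Psi f -> {within K, continuous g} ->
          exists Q : nat -> {poly R[i]},
            (norm_Psi Psi (fun z => (Q n).[z] - f z)%R
             + sup_on K (fun z => (Q n).[z] - g z)%R)%E @[n --> \oo] --> (0%:E : \bar R)].
Proof.
move=> yP rP eps eps0.
have e0 : 0 < Num.min eps 1 by rewrite lt_min eps0 /=.
have e1 : Num.min eps 1 <= 1 by rewrite ge_min lexx orbT.
have [K [KT cK bigK [z0 Kz0] hp]] := exists_compact Psi _ yP rP e0 e1.
exists K; split=> //.
  by apply: le_lt_trans bigK; rewrite lee_fin lerB // ge_min lexx.
move=> f g [_ ff] cg.
have ex (n : nat) : exists Q : {poly R[i]},
    (norm_Psi Psi (fun z => (Q.[z] - f z)%R) <= (n.+1%:R^-1)%:E)%E /\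
    forall z, K z -> modulus (Q.[z] - g z : CC R) <= n.+1%:R^-1.
  by apply: approximation => //; rewrite invr_gt0.
have [Q hQ] := choice ex; exists Q.
have c0 : ((2 * n.+1%:R^-1)%:E : \bar R) @[n --> \oo] --> (0%:E : \bar R).
  apply/fine_cvgP; split; first exact: nearW.
  rewrite -[X in _ --> X](mulr0 2).
  by apply: cvgM; [exact: cvg_cst|exact: cvg_harmonic].
apply: (squeeze_cvge _ (cvg_cst (0%:E : \bar R)) c0).
apply: nearW => n; have [h1 h2] := hQ n; apply/andP; split.
  apply: adde_ge0; first exact: norm_Psi_ge0.
  apply: (@le_trans _ _ (modulus ((Q n).[z0] - g z0 : CC R))%:E).
    by rewrite lee_fin modulus_ge0.
  by apply: ereal_sup_ubound; exists z0.
rewrite mulr2n mulrDl mul1r EFinD leeD //.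
by apply: ge_ereal_sup => _ [z Kz <-]; rewrite lee_fin h2.
Qed.
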